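(* Let $a,b\in\mathbb{R}$ with $b\neq 0$, let $\Lambda=b\,Y_1\wedge Y_2+2b\,Y_2\wedge Y_3+a\,Y_3\wedge Y_1$ on $\mathbb{R}^3$, and let $\mathcal{R}$ be the complex of formal multivector fields with differential $[\Lambda,\cdot]$. Let $D=(x_1^2+x_2^2)x_3$. Then: (i) if $a\neq0$, $H^2(\mathcal{R})=H^2_{2,3}(\mathcal{R})=\mathbb{R}Y_{23}+\mathbb{R}Y_{31}+\mathbb{R}Y_{12}$; (ii) if $a=0$, $$H^2(\mathcal{R})=\bigoplus_{k=1}^{\infty}H^2_{2k,3k}(\mathcal{R})\oplus\bigoplus_{m=1}^{\infty}H^2_{m,m}(\mathcal{R})\oplus\bigoplus_{m=1}^{\infty}H^2_{0,m}(\mathcal{R})$$ $$=\bigoplus_{m=0}^{\infty}D^{m}\left(\mathbb{R}Y_{23}+\mathbb{R}Y_{31}+\mathbb{R}Y_{12}\right)\oplus\bigoplus_{m=1}^{\infty}x_1^{m-2}\left(\mathbb{R}\,x_1\partial_{23}+\mathbb{R}\,(x_1\partial_{31}+(m-1)x_2\partial_{23})\right)\oplus\bigoplus_{m=0}^{\infty}\mathbb{R}\,x_3^{m}\partial_{12}.$$ (Infinite $\bigoplus$ over degrees denotes formal, possibly infinite, sums.)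
   Context: Coordinates $x_1,x_2,x_3$ on $\mathbb{R}^3$, $\partial_i=\partial/\partial x_i$, $\partial_{ij}=\partial_i\wedge\partial_j$. $Y_1=x_1\partial_1+x_2\partial_2$, $Y_2=x_1\partial_2-x_2\partial_1$, $Y_3=x_3\partial_3$ (pairwise commuting), $Y_{ij}=Y_i\wedge Y_j$. $\Lambda$ is a Poisson tensor. $\mathcal{R}^d$ ($d=0,1,2,3$) is the space of $d$-vector fields on $\mathbb{R}^3$ with coefficients in $\mathbb{R}[[x_1,x_2,x_3]]$, and the differential is the Lichnerowicz–Poisson operator $[\Lambda,\cdot]$ (Schouten bracket), so $H(\mathcal{R})$ is the formal Poisson cohomology of $\Lambda$. Bigrading: for $0\le k\le r$ let $P_{kr}=\mathrm{span}_{\mathbb{R}}\{x_1^{\ell}x_2^{k-\ell}x_3^{r-k}:0\le\ell\le k\}$, and $P_{kr}=0$ otherwise. Put $\mathcal{R}^0_{kr}=P_{k-2,r-3}$, $\mathcal{R}^1_{kr}=P_{k-1,r-2}\partial_1+P_{k-1,r-2}\partial_2+P_{k-2,r-2}\partial_3$, $\mathcal{R}^2_{kr}=P_{k-1,r-1}\partial_{23}+P_{k-1,r-1}\partial_{31}+P_{k,r-1}\partial_{12}$, $\mathcal{R}^3_{kr}=P_{kr}\,\partial_1\wedge\partial_2\wedge\partial_3$. Then $\mathcal{R}^d$ is the space of formal sums of elements of the $\mathcal{R}^d_{kr}$ and the differential preserves $(k,r)$; $H^d_{k,r}(\mathcal{R})$ denotes the degree-$d$ cohomology of the $(k,r)$-part.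 Writing a cohomology space as a space of cochains means that these cochains are cocycles and that each class has exactly one representative in that space. For $m=1$ the middle summand in (ii) is $\mathbb{R}\partial_{23}+\mathbb{R}\partial_{31}$. *)

(* Defs.v *)
From mathcomp Require Import all_boot all_order all_algebra.
From mathcomp Require Import mpoly.
From mathcomp Require Import boolp classical_sets functions cardinality fsbigop.
From mathcomp Require Import reals.

Set Implicit Arguments.
Unset Strict Implicit.
Unset Printing Implicit Defensive.

Import GRing.Theory Num.Theory.

Local Open Scope classical_set_scope.
Local Open Scope ring_scope.

(* The coordinate x_i, i = 1, 2, 3, has index i - 1 in 'I_3. *)
Definition ix1 : 'I_3 := @Ordinal 3 0 isT.
Definition ix2 : 'I_3 := @Ordinal 3 1 isT.
Definition ix3 : 'I_3 := @Ordinal 3 2 isT.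

Definition rspan (R : realType) (V : lmodType R) (s : seq V) : set V :=
  [set v | exists c : nat -> R, v = \sum_(i < size s) c i *: s`_i].

(* R[[x1, x2, x3]]: a series is its family of coefficients.  The value type is
   R^o so that *: is coefficientwise scaling.  The product of series is
   [fps_mul]; the generic * and 1 on function types are pointwise and are
   not used. *)
Definition fps (R : realType) : Type := 'X_{1..3} -> R^o.

Definition fps_monom (R : realType) (p : 'X_{1..3}) : fps R :=
  fun m => (m == p)%:R.

Definition fps_var (R : realType) (i : 'I_3) : fps R := fps_monom R U_(i)%MM.

Definition fps_one (R : realType) : fps R := fps_monom R 0%MM.

(* Cauchy product; the range of k covers all decompositions of m. *)
Definition fps_mul (R : realType) (f g : fps R) : fps R :=
  fun m => \sum_(k : 'X_{1..3 < (mdeg m).+1, (mdeg m).+1}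
                 | m == (k.1 + k.2)%MM) f k.1 * g k.2.

Definition fps_exp (R : realType) (f : fps R) (n : nat) : fps R :=
  iter n (fps_mul f) (fps_one R).

Definition fps_deriv (R : realType) (i : 'I_3) (f : fps R) : fps R :=
  fun m => f (m + U_(i))%MM *+ (m i).+1.

(* Inhomogeneous multivector fields: A I is the coefficient of
   d_{i_1} /\ ... /\ d_{i_p} for I = {i_1 < ... < i_p}. *)
Definition mvf (R : realType) : Type := {set 'I_3} -> fps R.

Definition fps_scale (R : realType) (f : fps R) (A : mvf R) : mvf R :=
  fun I => fps_mul f (A I).

Definition partial (R : realType) (i : 'I_3) : mvf R :=
  fun I => if I == [set i]%SET then fps_one R else 0.

(* d_I /\ d_J = wedge_sign I J d_(I :|: J) for disjoint I and J. *)
Definition wedge_sign (R : realType) (I J : {set 'I_3}) : R :=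
  (-1) ^+ #|[pred p : 'I_3 * 'I_3 |
             [&& p.1 \in I, p.2 \in J & (p.2 < p.1)%N]]|.

Definition wedge (R : realType) (A B : mvf R) : mvf R := fun K =>
  \sum_(I : {set 'I_3} | I \subset K)
     wedge_sign R I (K :\: I)%SET *: fps_mul (A I) (B (K :\: I)%SET).

Definition mvf_deriv (R : realType) (i : 'I_3) (A : mvf R) : mvf R :=
  fun I => fps_deriv i (A I).

(* Left and right derivatives with respect to the odd variable d_i. *)
Definition odd_derivL (R : realType) (i : 'I_3) (A : mvf R) : mvf R :=
  fun K => if i \in K then 0
           else wedge_sign R [set i]%SET K *: A (i |: K)%SET.
Definition odd_derivR (R : realType) (i : 'I_3) (A : mvf R) : mvf R :=
  fun K => if i \in K then 0
           else wedge_sign R K [set i]%SET *: A (i |: K)%SET.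

(* The Schouten bracket as the odd Poisson bracket in the pairs (d_i, x_i),
   normalized by [X, f] = X f and [X, Y] = the Lie bracket. *)
Definition schouten (R : realType) (A B : mvf R) : mvf R :=
  \sum_(i < 3) (wedge (odd_derivR i A) (mvf_deriv i B)
                - wedge (mvf_deriv i A) (odd_derivL i B)).

Definition is_formal_sum (R : realType) (J : choiceType) (F : J -> mvf R)
    (A : mvf R) : Prop :=
  forall (I : {set 'I_3}) (m : 'X_{1..3}),
    finite_set [set j | F j I m != 0] /\
    A I m = \sum_(j \in [set: J]) F j I m.

Definition formal_sums (R : realType) (J : choiceType)
    (V : J -> set (mvf R)) : set (mvf R) :=
  [set A | exists2 F : J -> mvf R, (forall j, V j (F j)) & is_formal_sum F A].

(* Every family in the V j has a formal sum, which determines the family. *)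
Definition formally_direct (R : realType) (J : choiceType)
    (V : J -> set (mvf R)) : Prop :=
  (forall F : J -> mvf R, (forall j, V j (F j)) ->
     exists A, is_formal_sum F A) /\
  (forall (F G : J -> mvf R) (A : mvf R),
     (forall j, V j (F j)) -> (forall j, V j (G j)) ->
     is_formal_sum F A -> is_formal_sum G A -> forall j, F j = G j).

Definition Rformal (R : realType) (d : nat) : set (mvf R) :=
  [set A | forall I : {set 'I_3}, #|I| != d -> (A : mvf R) I = 0].
Arguments Rformal : clear implicits.

(* Integer indices, as P_kr is used with possibly negative shifted indices. *)
Definition Pkr (R : realType) (k r : int) : set (fps R) :=
  if (0 <= k) && (k <= r) then
    rspan [seq fps_monom R (U_(ix1) *+ l + U_(ix2) *+ (`|k|%N - l)
                           + U_(ix3) *+ `|r - k|%N)%MM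
         | l <- iota 0 `|k|%N.+1]
  else [set 0].
Arguments Pkr : clear implicits.

Definition d12 (R : realType) : mvf R := wedge (partial R ix1) (partial R ix2).
Definition d23 (R : realType) : mvf R := wedge (partial R ix2) (partial R ix3).
Definition d31 (R : realType) : mvf R := wedge (partial R ix3) (partial R ix1).

(* The degree d part of bidegree kr.1, kr.2.  The unit multivector field
   [fun I => if I == set0 then fps_one R else 0] spans degree 0. *)
Definition Rbi (R : realType) (kr : nat * nat) (d : nat) : set (mvf R) :=
  let k : int := kr.1%:Z in
  let r : int := kr.2%:Z in
  match d with
  | 0 => [set A | exists2 f, Pkr R (k - 2) (r - 3) f
                & A = fps_scale f (fun I => if I == finset.set0
                                            then fps_one R else 0)]
  | 1 => [set A | exists f g h, [/\ Pkr R (k - 1) (r - 2) f,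
                                    Pkr R (k - 1) (r - 2) g,
                                    Pkr R (k - 2) (r - 2) h
                & A = fps_scale f (partial R ix1) + fps_scale g (partial R ix2)
                      + fps_scale h (partial R ix3)]]
  | 2 => [set A | exists f g h, [/\ Pkr R (k - 1) (r - 1) f,
                                    Pkr R (k - 1) (r - 1) g,
                                    Pkr R k (r - 1) h
                & A = fps_scale f (d23 R) + fps_scale g (d31 R)
                      + fps_scale h (d12 R)]]
  | 3 => [set A | exists2 f, Pkr R k r f
                & A = fps_scale f (wedge (partial R ix1) (d23 R))]
  | _ => [set 0]
  end.
Arguments Rbi : clear implicits.

Definition cocycles (R : realType) (L : mvf R) (C : nat -> set (mvf R))
    (d : nat) : set (mvf R) :=
  [set A | C d A /\ schouten L A = 0].

Definition coboundaries (R : realType) (L : mvf R) (C : nat -> set (mvf R))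
    (d : nat) : set (mvf R) :=
  if d is d'.+1 then [set schouten L X | X in C d'] else [set 0].

(* H^d(C) = V, for a space V of cochains: V consists of cocycles and contains
   exactly one representative of each class. *)
Definition cohomology_is (R : realType) (L : mvf R) (C : nat -> set (mvf R))
    (d : nat) (V : set (mvf R)) : Prop :=
  V `<=` cocycles L C d /\
  forall A, cocycles L C d A ->
    exists! B, V B /\ coboundaries L C d (A - B).

(* H^d(Rformal) is the (formal) direct sum over j of the cohomology spaces of
   the bidegree idx j parts: formal summation of cocycles induces a map from
   the product of these spaces to H^d(Rformal) that is well defined and
   injective (first clause) and surjective (second clause). *)
Definition cohomology_dsum (R : realType) (L : mvf R) (d : nat)
    (J : choiceType) (idx : J -> nat * nat) : Prop :=
  (forall F : J -> mvf R,
     (forall j, cocycles L (Rbi R (idx j)) d (F j)) ->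
     exists A, [/\ is_formal_sum F A, cocycles L (Rformal R) d A
       & coboundaries L (Rformal R) d A <->
         forall j, coboundaries L (Rbi R (idx j)) d (F j)]) /\
  (forall A, cocycles L (Rformal R) d A ->
     exists F S, [/\ forall j, cocycles L (Rbi R (idx j)) d (F j),
       is_formal_sum F S & coboundaries L (Rformal R) d (A - S)]).

Definition Y1 (R : realType) : mvf R :=
  fps_scale (fps_var R ix1) (partial R ix1)
  + fps_scale (fps_var R ix2) (partial R ix2).
Definition Y2 (R : realType) : mvf R :=
  fps_scale (fps_var R ix1) (partial R ix2)
  - fps_scale (fps_var R ix2) (partial R ix1).
Definition Y3 (R : realType) : mvf R :=
  fps_scale (fps_var R ix3) (partial R ix3).
Definition Y12 (R : realType) : mvf R := wedge (Y1 R) (Y2 R).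
Definition Y23 (R : realType) : mvf R := wedge (Y2 R) (Y3 R).
Definition Y31 (R : realType) : mvf R := wedge (Y3 R) (Y1 R).

Definition Dcas (R : realType) : fps R :=
  fps_mul (fps_exp (fps_var R ix1) 2 + fps_exp (fps_var R ix2) 2)
          (fps_var R ix3).

(* x1^(m-2) (R x1 d23 + R (x1 d31 + (m-1) x2 d23)) for m >= 2; for m = 1 the
   formal factor x1^(-1) cancels.  Used for m >= 1 only. *)
Definition Wmm (R : realType) (m : nat) : set (mvf R) :=
  if m == 1%N then rspan [:: d23 R; d31 R]
  else [set fps_scale (fps_exp (fps_var R ix1) (m - 2)) A | A in
          rspan [:: fps_scale (fps_var R ix1) (d23 R);
                   fps_scale (fps_var R ix1) (d31 R)
                   + (m - 1)%:R *: fps_scale (fps_var R ix2) (d23 R)]].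
Arguments Wmm : clear implicits.

(* Main.v *)
(** Replace a cochain A by the scalars g_i = A /\ Y_i.  In the variables
    z = x1 + i x2, z' = x1 - i x2, x3 the operator [Lambda, -] is diagonal, so the
    complexified complex splits into one small complex for each monomial
    z^al z'^be x3^ga.  It is the part of the Koszul complex of three scalars cut
    out by the conditions that a cochain has no pole (conditions present only when
    al, be or ga vanishes).  These scalars are linear in the exponents, and the
    small complex is exact in degree 2 except at al = be = ga >= 1 (when a = 0 or
    ga = 1) and, when a = 0, at z^m, z'^m and x3^m with m >= 1.  The listed
    representatives of a bidegree are separated by the coefficients at these
    monomials.  Real primitives are real parts of complex ones, and since Lambda
    has weight zero for the bigrading, bidegreewise results glue to formal
    series. *)
Require Import Defs.
From HB Require Import structures.
From mathcomp Require Import all_boot all_order all_algebra.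
From mathcomp Require Import mpoly complex.
From mathcomp Require Import boolp classical_sets functions cardinality fsbigop.
From mathcomp Require Import reals.
From mathcomp Require Import zify ring.
Set Implicit Arguments.
Unset Strict Implicit.
Unset Printing Implicit Defensive.
Import GRing.Theory Num.Theory.
Local Open Scope classical_set_scope.
Local Open Scope ring_scope.

(** The scalars diagonalize the differential because the Y_i commute: up to sign [Lambda, -] is the
    sum of Y_i /\ L_(X_i), each X_i being a constant combination of the Y_j, and Y1, Y2, Y3 act on
    z^al z'^be x3^ga by al + be, i (al - be) and ga. Since Y1 /\ Y2 /\ Y3 is D = z z' x3 times d1 /\
    d2 /\ d3, a scalar A /\ Y_i is a coefficient in the Y-frame multiplied by D, so the eigenvalues
    are taken at exponents lowered by one. The three Koszul scalars are X_2 - i X_1, X_2 + i X_1 and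
    X_3; as a, b are real and b != 0, each vanishes only under two real equations. The obstacle is
    the boundary: the Koszul homotopy divides by a nonzero scalar, but its result must again have no
    pole. Dividing by X_2 - i X_1 is safe when al > 0, by X_2 + i X_1 when be > 0, by X_3 when ga >
    0. A monomial is exceptional when no safe division exists and the no-pole conditions still leave
    room for a nonzero cochain. The coefficient 2b of Y2 /\ Y3 makes X_2 = 2b Y3 - b Y1 kill D;
    since X_1 D = - a D and X_3 D = 2a D, D is a Casimir exactly when a = 0. *)

Local Notation x1 := ('X_ix1).
Local Notation x2 := ('X_ix2).
Local Notation x3 := ('X_ix3).

(** * Polynomial multivector fields *)

Section PolynomialFields.
Variable R : realType.
Implicit Types p q : {mpoly R[3]}.

(** Every bidegree piece consists of polynomial fields, so brackets are computed in [{mpoly R[3]}],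
    where [ring] applies; genuine power series appear only in the gluing. *)
Definition fps_of p : fps R := fun m => p@_m.

Lemma fps_mul_of p q : fps_mul (fps_of p) (fps_of q) = fps_of (p * q).
Proof. by apply/funext => m; rewrite /fps_of mcoeffM. Qed.

Lemma fps_deriv_of i p : fps_deriv i (fps_of p) = fps_of p^`M(i).
Proof. by apply/funext => m; rewrite /fps_of mcoeff_mderiv. Qed.

Lemma fps_monom_of m : fps_monom R m = fps_of 'X_[m].
Proof. by apply/funext => k; rewrite /fps_of mcoeffX eq_sym. Qed.

Lemma fps_one_of : fps_one R = fps_of 1.
Proof. by rewrite /fps_one fps_monom_of mpolyX0. Qed.

Lemma fps_of0 : fps_of 0 = 0.
Proof. by apply/funext => k; rewrite /fps_of mcoeff0. Qed.

Lemma fps_ofD p q : fps_of p + fps_of q = fps_of (p + q).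
Proof. by apply/funext => k; rewrite /fps_of mcoeffD. Qed.

Lemma fps_ofN p : - fps_of p = fps_of (- p).
Proof. by apply/funext => k; rewrite /fps_of mcoeffN. Qed.

Lemma fps_ofZ (x : R) p : x *: fps_of p = fps_of (x%:MP * p).
Proof. by apply/funext => k; rewrite /fps_of mcoeffCM. Qed.

Lemma fps_exp_of p n : fps_exp (fps_of p) n = fps_of (p ^+ n).
Proof.
elim: n => [|n IH]; first by rewrite /fps_exp /= fps_one_of expr0.
rewrite /fps_exp iterS -/(fps_exp _ _).
by rewrite IH fps_mul_of exprS.
Qed.

(* Index sets I are encoded by the booleans (1 \in I, 2 \in I, 3 \in I), so that
   sums over subsets can be expanded by computation. *)
Definition bset (e : bool * bool * bool) : {set 'I_3} :=
  [set i : 'I_3 | nth false [:: e.1.1; e.1.2; e.2] i]%SET.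
Definition setb (I : {set 'I_3}) : bool * bool * bool :=
  (ix1 \in I, ix2 \in I, ix3 \in I).

Lemma ord3P (P : 'I_3 -> Prop) : P ix1 -> P ix2 -> P ix3 -> forall i, P i.
Proof.
move=> h1 h2 h3 [[|[|[|//]]] Hi].
- by rewrite (_ : Ordinal Hi = ix1) //; apply: val_inj.
- by rewrite (_ : Ordinal Hi = ix2) //; apply: val_inj.
- by rewrite (_ : Ordinal Hi = ix3) //; apply: val_inj.
Qed.

Lemma bsetK : cancel bset setb.
Proof. by move=> [[e1 e2] e3]; rewrite /setb !inE. Qed.

Lemma setbK : cancel setb bset.
Proof. by move=> I; apply/finset.setP; apply: ord3P; rewrite !inE. Qed.

Lemma big_ord3 (V : zmodType) (F : 'I_3 -> V) :
  \sum_(i < 3) F i = F ix1 + F ix2 + F ix3.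
Proof.
by rewrite !big_ord_recl big_ord0 addr0 addrA; congr (F _ + F _ + F _);
   apply: val_inj.
Qed.

Definition bsub (e f : bool * bool * bool) : bool :=
  [&& e.1.1 ==> f.1.1, e.1.2 ==> f.1.2 & e.2 ==> f.2].
Definition bdiff (f e : bool * bool * bool) : bool * bool * bool :=
  (f.1.1 && ~~ e.1.1, f.1.2 && ~~ e.1.2, f.2 && ~~ e.2).
Definition bsign (e f : bool * bool * bool) : nat :=
  ((e.1.2 && f.1.1) + (e.2 && f.1.1) + (e.2 && f.1.2))%N.

Lemma bset_sub (I : {set 'I_3}) e : (bset e \subset I) = bsub e (setb I).
Proof.
apply/fintype.subsetP/idP => [h|/and3P[/implyP h1 /implyP h2 /implyP h3]].
  by apply/and3P; split; apply/implyP => he; apply: h; rewrite inE.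
by apply: ord3P; rewrite inE.
Qed.

Lemma bset_diff (I : {set 'I_3}) e : (I :\: bset e)%SET = bset (bdiff (setb I) e).
Proof. by apply/finset.setP; apply: ord3P; rewrite !inE andbC. Qed.

Lemma wedge_sign_bset e f : wedge_sign R (bset e) (bset f) = (-1) ^+ bsign e f.
Proof.
rewrite /wedge_sign; congr (_ ^+ _).
rewrite -sum1_card big_mkcond /=.
rewrite -(pair_bigA _ (fun i j : 'I_3 =>
  if (i, j) \in [pred p : 'I_3 * 'I_3 |
       [&& p.1 \in bset e, p.2 \in bset f & (p.2 < p.1)%N]] then 1%N else 0%N)).
rewrite !big_ord_recl !big_ord0 !inE /= /bsign.
by case: e f => [[[] []] []] [[[] []] []].
Qed.

Definition mvp (c : bool * bool * bool -> {mpoly R[3]}) : mvf R :=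
  fun I => fps_of (c (setb I)).

Lemma big_bool3 (V : zmodType) (F : bool * bool * bool -> V) :
  \sum_e F e = \sum_(x : bool) \sum_(y : bool) \sum_(z : bool) F (x, y, z).
Proof. by rewrite !pair_bigA; apply: eq_bigr => -[[]]. Qed.

Definition bwedge (c c' : bool * bool * bool -> {mpoly R[3]}) f :=
  \sum_(e | bsub e f) (-1) ^+ bsign e (bdiff f e) * (c e * c' (bdiff f e)).

Lemma wedge_mvp c c' : wedge (mvp c) (mvp c') = mvp (bwedge c c').
Proof.
apply/funext => K; rewrite /wedge /mvp /bwedge.
rewrite (reindex bset) /=; last by exists setb => ? _; rewrite ?bsetK ?setbK.
transitivity (\sum_(e | bsub e (setb K)) fps_of
   ((-1) ^+ bsign e (bdiff (setb K) e) * (c e * c' (bdiff (setb K) e)))).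
  apply: eq_big => [e|e _]; first by rewrite bset_sub.
  rewrite bset_diff wedge_sign_bset !bsetK fps_mul_of fps_ofZ.
  by rewrite rmorphXn /= rmorphN1.
by apply/esym; elim/big_rec2: _ => [|e p q _ <-]; rewrite ?fps_of0 ?fps_ofD.
Qed.

Definition bin (i : 'I_3) (e : bool * bool * bool) : bool :=
  nth false [:: e.1.1; e.1.2; e.2] i.
Definition bor (e f : bool * bool * bool) : bool * bool * bool :=
  (e.1.1 || f.1.1, e.1.2 || f.1.2, e.2 || f.2).
Definition bunit (i : 'I_3) : bool * bool * bool := setb [set i]%SET.

Lemma mem_setb i (K : {set 'I_3}) : (i \in K) = bin i (setb K).
Proof. by move: i; apply: ord3P. Qed.

Lemma setbU1 i (K : {set 'I_3}) : setb (i |: K)%SET = bor (bunit i) (setb K).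
Proof. by rewrite /bunit /setb /bor /= !inE. Qed.

Lemma wedge_signE (I J : {set 'I_3}) :
  wedge_sign R I J = (-1) ^+ bsign (setb I) (setb J).
Proof. by rewrite -wedge_sign_bset !setbK. Qed.

Definition boddL i (c : bool * bool * bool -> {mpoly R[3]}) f :=
  if bin i f then 0 else (-1) ^+ bsign (bunit i) f * c (bor (bunit i) f).
Definition boddR i (c : bool * bool * bool -> {mpoly R[3]}) f :=
  if bin i f then 0 else (-1) ^+ bsign f (bunit i) * c (bor (bunit i) f).

Lemma odd_derivL_mvp i c : odd_derivL i (mvp c) = mvp (boddL i c).
Proof.
apply/funext => K; rewrite /odd_derivL /mvp /boddL mem_setb setbU1.
case: ifP => _; first by rewrite fps_of0.
by rewrite wedge_signE fps_ofZ rmorphXn /= rmorphN1.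
Qed.

Lemma odd_derivR_mvp i c : odd_derivR i (mvp c) = mvp (boddR i c).
Proof.
apply/funext => K; rewrite /odd_derivR /mvp /boddR mem_setb setbU1.
case: ifP => _; first by rewrite fps_of0.
by rewrite wedge_signE fps_ofZ rmorphXn /= rmorphN1.
Qed.

Lemma mvf_deriv_mvp i c :
  mvf_deriv i (mvp c) = mvp (fun f => (c f)^`M(i)).
Proof. by apply/funext => K; rewrite /mvf_deriv /mvp fps_deriv_of. Qed.

Lemma mvpD c c' : mvp c + mvp c' = mvp (fun f => c f + c' f).
Proof. by apply/funext => K; rewrite /mvp -fps_ofD. Qed.

Lemma mvpN c : - mvp c = mvp (fun f => - c f).
Proof. by apply/funext => K; rewrite /mvp -fps_ofN. Qed.

Lemma mvpZ (x : R) c : x *: mvp c = mvp (fun f => x%:MP * c f).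
Proof. by apply/funext => K; rewrite /mvp -fps_ofZ. Qed.

Lemma fps_scale_mvp p c : fps_scale (fps_of p) (mvp c) = mvp (fun f => p * c f).
Proof. by apply/funext => K; rewrite /fps_scale /mvp fps_mul_of. Qed.

Lemma partial_mvp i : partial R i = mvp (fun f => (f == bunit i)%:R).
Proof.
apply/funext => K; rewrite /partial /mvp /bunit (can_eq setbK).
by case: ifP; rewrite ?fps_one_of ?fps_of0.
Qed.

Lemma eq_mvp c c' : c =1 c' -> mvp c = mvp c'.
Proof. by move=> h; apply/funext => K; rewrite /mvp h. Qed.

Definition bschouten c c' f : {mpoly R[3]} :=
  \sum_(i < 3) (bwedge (boddR i c) (fun f => (c' f)^`M(i)) f
                - bwedge (fun f => (c f)^`M(i)) (boddL i c') f).

Lemma schouten_mvp c c' : schouten (mvp c) (mvp c') = mvp (bschouten c c').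
Proof.
rewrite /schouten big_ord3.
rewrite !odd_derivR_mvp !odd_derivL_mvp !mvf_deriv_mvp !wedge_mvp.
by rewrite !mvpN !mvpD; apply: eq_mvp => f; rewrite /bschouten big_ord3.
Qed.

Definition mv1 p1 p2 p3 := mvp (fun f => match f with
  | (true, false, false) => p1 | (false, true, false) => p2
  | (false, false, true) => p3 | _ => 0 end).
(** The arguments are the coefficients of d23, d31, d12. The component on {1, 3} refers to d13 = -
    d31, hence the sign. *)
Definition mv2 p1 p2 p3 := mvp (fun f => match f with
  | (false, true, true) => p1 | (true, false, true) => - p2
  | (true, true, false) => p3 | _ => 0 end).
Definition mv3 p := mvp (fun f => if f is (true, true, true) then p else 0).

Lemma bunitE i : bunit i = (i == ix1, i == ix2, i == ix3).
Proof. by rewrite /bunit /setb !inE ![ix1 == _]eq_sym ![ix2 == _]eq_sym ![ix3 ==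
    _]eq_sym. Qed.

(** Packed as one multirule, so that a single [rewrite] expands whichever component occurs and each
    bracket becomes a polynomial identity. *)
Lemma bwedgeE c c' :
  (bwedge c c' (false, false, false) = c (false, false, false) * c' (false, false,
      false)) *
  (bwedge c c' (false, false, true) = c (false, false, false) * c' (false, false,
      true) + c (false, false, true) * c' (false, false, false)) *
  (bwedge c c' (false, true, false) = c (false, false, false) * c' (false, true,
      false) + c (false, true, false) * c' (false, false, false)) *
  (bwedge c c' (false, true, true) = c (false, false, false) * c' (false, true,
      true) - c (false, false, true) * c' (false, true, false) + c (false, true,
          false) * c' (false, false, true) + c (false, true, true) * c' (false, false,
              false)) *
  (bwedge c c' (true, false, false) = c (false, false, false) * c' (true, false,
      false) + c (true, false, false) * c' (false, false, false)) *
  (bwedge c c' (true, false, true) = c (false, false, false) * c' (true, false,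
      true) - c (false, false, true) * c' (true, false, false) + c (true, false,
          false) * c' (false, false, true) + c (true, false, true) * c' (false, false,
              false)) *
  (bwedge c c' (true, true, false) = c (false, false, false) * c' (true, true,
      false) - c (false, true, false) * c' (true, false, false) + c (true, false,
          false) * c' (false, true, false) + c (true, true, false) * c' (false, false,
              false)) *
  (bwedge c c' (true, true, true) = c (false, false, false) * c' (true, true,
      true) + c (false, false, true) * c' (true, true, false) - c (false, true,
          false) * c' (true, false, true) + c (false, true, true) * c' (true, false,
              false) + c (true, false, false) * c' (false, true, true) - c (true,
                  false, true) * c' (false, true, false) + c (true, true,
                      false) * c' (false, false, true) + c (true, true,
                          true) * c' (false, false, false)).
Proof.
do !split; rewrite /bwedge big_mkcond big_bool3 !big_bool /bsub /bdiff /bsign /=;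
  rewrite ?(expr0, expr1, addn0, add0n); ring.
Qed.

Lemma d23E : d23 R = mv2 1 0 0.
Proof.
rewrite /d23 !partial_mvp wedge_mvp !bunitE; apply: eq_mvp.
by move=> [[[] []] []]; rewrite bwedgeE /=; ring.
Qed.

Lemma d31E : d31 R = mv2 0 1 0.
Proof.
rewrite /d31 !partial_mvp wedge_mvp !bunitE; apply: eq_mvp.
by move=> [[[] []] []]; rewrite bwedgeE /=; ring.
Qed.

Lemma d12E : d12 R = mv2 0 0 1.
Proof.
rewrite /d12 !partial_mvp wedge_mvp !bunitE; apply: eq_mvp.
by move=> [[[] []] []]; rewrite bwedgeE /=; ring.
Qed.

Lemma mderivXU (K : comNzRingType) (i j : 'I_3) :
  ('X_j : {mpoly K[3]})^`M(i) = (i == j)%:R.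
Proof.
rewrite mderivX mnm1E eq_sym; case: eqP => [->|_]; last by rewrite scale0r.
rewrite scale1r (_ : (_ - _)%MM = 0%MM) ?mpolyX0 //.
by apply/mnmP => k; rewrite mnmBE subnn mnm0E.
Qed.

Section Differentials.
Variables (K : comNzRingType) (a b : K).
Local Notation P := {mpoly K[3]}.
Local Notation A := (a%:MP_[3]).
Local Notation B := (b%:MP_[3]).
(* The derivations Y1, Y2 and Y3. *)
Definition dE (p : P) : P := x1 * p^`M(ix1) + x2 * p^`M(ix2).
Definition dJ (p : P) : P := x1 * p^`M(ix2) - x2 * p^`M(ix1).
Definition dT (p : P) : P := x3 * p^`M(ix3).

(* [Lambda, -] is, up to sign, the sum of Y_i /\ L_(X_i) with X_1 = b Y2 - a Y3,
   X_2 = 2 b Y3 - b Y1, X_3 = a Y1 - 2 b Y2; below it acts on the coefficients of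
   d23, d31, d12 (d2) and of d1, d2, d3 (d1_1, d1_2, d1_3). *)
Definition d2 (q1 q2 q3 : P) : P :=
  x3 * (2 * B * dJ q3 - A * dE q3) + 2 * B * dT (x2 * q1 - x1 * q2)
  + A * dT (x1 * q1 + x2 * q2)
  + B * (x1 * dE q2 - x2 * dJ q2 - x1 * dJ q1 - x2 * dE q1)
  - A * (x1 * q1 + x2 * q2) + 2 * A * x3 * q3.
Definition d1_1 (p1 p2 p3 : P) : P :=
  x2 * (B * dJ p3 - A * (dT p3 - p3)) + x1 * (2 * B * (dT p3 - p3) - B * dE p3)
  - x3 * (A * (dE p2 - p2) - 2 * B * (dJ p2 - p1)).
Definition d1_2 (p1 p2 p3 : P) : P :=
  - x1 * (B * dJ p3 - A * (dT p3 - p3)) + x2 * (2 * B * (dT p3 - p3) - B * dE p3)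
  + x3 * (A * (dE p1 - p1) - 2 * B * (dJ p1 + p2)).
Definition d1_3 (p1 p2 p3 : P) : P :=
  x1 * (B * (dJ p2 - p1) - A * dT p2) - x2 * (B * (dJ p1 + p2) - A * dT p1)
  - x2 * (2 * B * dT p2 - B * (dE p2 - p2)) - x1 * (2 * B * dT p1 - B * (dE p1 - p1)).
End Differentials.

Section Compute.
Variables a b : R.
Local Notation A := (a%:MP_[3]).
Local Notation B := (b%:MP_[3]).

Definition Lam : mvf R := b *: wedge (Y1 R) (Y2 R) + (2 * b) *: wedge (Y2 R) (Y3 R)
                   + a *: wedge (Y3 R) (Y1 R).

Lemma fps_varE i : fps_var R i = fps_of 'X_i.
Proof. exact: fps_monom_of. Qed.

Lemma Y1E : Y1 R = mv1 x1 x2 0.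
Proof.
rewrite /Y1 !fps_varE !partial_mvp !fps_scale_mvp mvpD; apply: eq_mvp.
by move=> [[[] []] []]; rewrite !bunitE /=; ring.
Qed.

Lemma Y2E : Y2 R = mv1 (- x2) x1 0.
Proof.
rewrite /Y2 !fps_varE !partial_mvp !fps_scale_mvp mvpN mvpD; apply: eq_mvp.
by move=> [[[] []] []]; rewrite !bunitE /=; ring.
Qed.

Lemma Y3E : Y3 R = mv1 0 0 x3.
Proof.
rewrite /Y3 !fps_varE !partial_mvp !fps_scale_mvp; apply: eq_mvp.
by move=> [[[] []] []]; rewrite !bunitE /=; ring.
Qed.

Lemma Y12E : Y12 R = mv2 0 0 (x1 ^+ 2 + x2 ^+ 2).
Proof.
rewrite /Y12 Y1E Y2E wedge_mvp; apply: eq_mvp.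
by move=> [[[] []] []]; rewrite bwedgeE /=; ring.
Qed.

Lemma Y23E : Y23 R = mv2 (x1 * x3) (x2 * x3) 0.
Proof.
rewrite /Y23 Y3E Y2E wedge_mvp; apply: eq_mvp.
by move=> [[[] []] []]; rewrite bwedgeE /=; ring.
Qed.

Lemma Y31E : Y31 R = mv2 (- x2 * x3) (x1 * x3) 0.
Proof.
rewrite /Y31 Y3E Y1E wedge_mvp; apply: eq_mvp.
by move=> [[[] []] []]; rewrite bwedgeE /=; ring.
Qed.

Lemma LamE : Lam = mv2 ((2 * B * x1 - A * x2) * x3)
  ((2 * B * x2 + A * x1) * x3) (B * (x1 ^+ 2 + x2 ^+ 2)).
Proof.
rewrite /Lam -/(Y12 R) -/(Y23 R) -/(Y31 R) Y12E Y23E Y31E !mvpZ !mvpD.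
apply: eq_mvp => -[[[] []] []]; rewrite ?mpolyCM /=; try ring.
Qed.

Lemma schouten_mv2 q1 q2 q3 :
  schouten Lam (mv2 q1 q2 q3) = - mv3 (d2 a b q1 q2 q3).
Proof.
rewrite LamE schouten_mvp mvpN; apply: eq_mvp => f.
rewrite /bschouten big_ord3.
move: f => [[[] []] []];
rewrite !bwedgeE /boddL /boddR /bsign !bunitE /bor /bin /=
   /d2 /dJ /dT /dE
   !(mderivM, mderivD, mderivB, mderivN, mderivC, mderivXU, mderiv0, eqxx, expr2) /=;
 ring.
Qed.

Lemma schouten_mv1 p1 p2 p3 :
  schouten Lam (mv1 p1 p2 p3) =
    mv2 (d1_1 a b p1 p2 p3) (d1_2 a b p1 p2 p3) (d1_3 a b p1 p2 p3).
Proof.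
rewrite LamE schouten_mvp; apply: eq_mvp => f.
rewrite /bschouten big_ord3.
move: f => [[[] []] []];
rewrite !bwedgeE /boddL /boddR /bsign !bunitE /bor /bin /=
   /d1_1 /d1_2 /d1_3 /dJ /dT /dE
   !(mderivM, mderivD, mderivB, mderivN, mderivC, mderivXU, mderiv0, eqxx, expr2) /=;
 ring.
Qed.
End Compute.
End PolynomialFields.

(** * The differential in the variables z, z', x3 *)

(** Suited to identities between ring morphisms and derivations, which are determined by their
    values on ring generators. *)
Lemma mpoly_ring_ind n (A : comNzRingType) (Q : {mpoly A[n]} -> Prop) :
  (forall c, Q c%:MP) -> (forall i, Q 'X_i) ->
  (forall p q, Q p -> Q q -> Q (p + q)) ->
  (forall p q, Q p -> Q q -> Q (p * q)) -> forall p, Q p.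
Proof.
move=> QC QX QD QM; apply: (@mpolyind n A Q) => [|c m p _ _ Qp];
    first by rewrite -mpolyC0.
apply: (QD) => //; rewrite -mul_mpolyC; apply: (QM) => //.
rewrite mpolyXE_id; apply: (big_ind Q) => [||i _]; [by rewrite -mpolyC1|exact: QM|].
by elim: (m i) => [|k IH]; rewrite ?expr0 ?exprS -?mpolyC1 //; exact: QM.
Qed.

Section Spectral.
Variables (K : fieldType) (iu : K).
Hypotheses (iu2 : iu * iu = -1) (two_neq0 : 2 != 0 :> K).
Local Notation P := {mpoly K[3]}.
Implicit Types p q : P.

(* phi substitutes z = x1 + i x2, z' = x1 - i x2 for the variables; psi is its
   inverse.  So on the source of phi the variables x1, x2 stand for z, z'. *)
Definition phi p := p \mPo
  [tuple x1 + iu%:MP * x2; x1 - iu%:MP * x2; (x3 : P)].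
Definition psi p := p \mPo
  [tuple 2^-1%:MP * (x1 + x2); - (iu / 2)%:MP * (x1 - x2); (x3 : P)].

Lemma phiD : {morph phi : p q / p + q}. Proof. exact: comp_mpolyD. Qed.
Lemma phiM : {morph phi : p q / p * q}. Proof. by move=> p q; rewrite /phi rmorphM. Qed.
Lemma phiN : {morph phi : p / - p}. Proof. exact: comp_mpolyN. Qed.
Lemma phiB : {morph phi : p q / p - q}. Proof. exact: comp_mpolyB. Qed.
Lemma phiC c : phi c%:MP = c%:MP. Proof. exact: comp_mpolyC. Qed.
Lemma phi0 : phi 0 = 0. Proof. exact: comp_mpoly0. Qed.
Lemma phi1 : phi 1 = 1. Proof. by rewrite /phi rmorph1. Qed.
Lemma phiX1 : phi x1 = x1 + iu%:MP * x2. Proof. by rewrite /phi comp_mpolyXU. Qed.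
Lemma phiX2 : phi x2 = x1 - iu%:MP * x2. Proof. by rewrite /phi comp_mpolyXU. Qed.
Lemma phiX3 : phi x3 = x3. Proof. by rewrite /phi comp_mpolyXU. Qed.
Lemma psiD : {morph psi : p q / p + q}. Proof. exact: comp_mpolyD. Qed.
Lemma psiM : {morph psi : p q / p * q}. Proof. by move=> p q; rewrite /psi rmorphM. Qed.
Lemma psiN : {morph psi : p / - p}. Proof. exact: comp_mpolyN. Qed.
Lemma psiB : {morph psi : p q / p - q}. Proof. exact: comp_mpolyB. Qed.
Lemma psiC c : psi c%:MP = c%:MP. Proof. exact: comp_mpolyC. Qed.
Lemma psi0 : psi 0 = 0. Proof. exact: comp_mpoly0. Qed.
Lemma psiX1 : psi x1 = 2^-1%:MP * (x1 + x2). Proof. by rewrite /psi comp_mpolyXU. Qed.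
Lemma psiX2 : psi x2 = - (iu / 2)%:MP * (x1 - x2). Proof. by rewrite /psi comp_mpolyXU.
    Qed.
Lemma psiX3 : psi x3 = x3. Proof. by rewrite /psi comp_mpolyXU. Qed.

Lemma phi2 : phi 2 = 2. Proof. by rewrite /phi rmorph_nat. Qed.
Lemma mderiv2 i : (2 : P)^`M(i) = 0.
Proof. by rewrite -[2]/(1 *+ 2) -mpolyC1 -mpolyCMn mderivC. Qed.

Lemma mpC_iu2 : iu%:MP * iu%:MP = -1 :> P.
Proof. by rewrite -mpolyCM iu2 mpolyCN. Qed.

Lemma mpC_half : 2 * 2^-1%:MP = 1 :> P.
Proof. by rewrite -[2]/(1 *+ 2) -mpolyC1 -mpolyCMn -mpolyCM divff. Qed.

Lemma psiK : cancel psi phi.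
Proof.
apply: mpoly_ring_ind => [c|i|p q hp hq|p q hp hq].
- by rewrite psiC phiC.
- move: i; apply: ord3P.
  + rewrite psiX1 phiM phiC phiD phiX1 phiX2; ring: mpC_half.
  + rewrite psiX2 mpolyCM phiM phiN phiM !phiC phiB phiX1 phiX2.
    ring: mpC_half mpC_iu2.
  + by rewrite psiX3 phiX3.
- by rewrite psiD phiD hp hq.
- by rewrite psiM phiM hp hq.
Qed.

Lemma phiK : cancel phi psi.
Proof.
apply: mpoly_ring_ind => [c|i|p q hp hq|p q hp hq].
- by rewrite phiC psiC.
- move: i; apply: ord3P.
  + rewrite phiX1 psiD psiM psiX1 psiX2 psiC mpolyCM; ring: mpC_half mpC_iu2.
  + rewrite phiX2 psiB psiM psiX1 psiX2 psiC mpolyCM; ring: mpC_half mpC_iu2.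
  + by rewrite phiX3 psiX3.
- by rewrite phiD psiD hp hq.
- by rewrite phiM psiM hp hq.
Qed.

(** Abstracts the images under [phi], so that the goal left to [ring] is an identity between plain
    atoms. *)
Ltac gen_atoms := repeat match goal with
  | |- context [phi ?p] => let y := fresh "y" in move: (phi p) => y
  end.

(** Chain rule: d1 = d_z + d_z' and d2 = i (d_z - d_z'). Both sides obey the Leibniz rule along
    [phi], so generators suffice. *)
Lemma phi_deriv p : [/\ (phi p)^`M(ix1) = phi (p^`M(ix1) + p^`M(ix2)),
  (phi p)^`M(ix2) = iu%:MP * phi (p^`M(ix1) - p^`M(ix2))
  & (phi p)^`M(ix3) = phi p^`M(ix3)].
Proof.
elim/mpoly_ring_ind: p => [c|i|p q [hp1 hp2 hp3] [hq1 hq2 hq3]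
                          |p q [hp1 hp2 hp3] [hq1 hq2 hq3]].
- by rewrite phiC !mderivC addr0 subr0 phi0 mulr0.
- move: i; apply: ord3P; rewrite ?(phiX1, phiX2, phiX3)
    !(mderivD, mderivN, mderivM, mderivC, mderivXU, mderiv2, mpolyC0) /= ?(mulr1n,
        mulr0n);
  rewrite ?(phiD, phiB, phi0, phi1, addr0, add0r, subr0, sub0r, phiN); split; ring.
- by rewrite phiD !mderivD hp1 hp2 hp3 hq1 hq2 hq3 !(phiD, phiN); gen_atoms;
    split=> //; ring.
- rewrite phiM !mderivM hp1 hp2 hp3 hq1 hq2 hq3 !(phiD, phiN, phiM); gen_atoms;
    split=> //; ring.
Qed.

Lemma dE_phi p : dE (phi p) = phi (x1 * p^`M(ix1) + x2 * p^`M(ix2)).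
Proof.
have [h1 h2 _] := phi_deriv p; rewrite /dE h1 h2 !(phiD, phiN, phiM, phiX1, phiX2).
ring: mpC_iu2.
Qed.

(** The rotation becomes i (z d_z - z' d_z'), diagonal on monomials; this is what complexification
    is for. *)
Lemma dJ_phi p : dJ (phi p) = iu%:MP * phi (x1 * p^`M(ix1) - x2 * p^`M(ix2)).
Proof.
have [h1 h2 _] := phi_deriv p; rewrite /dJ h1 h2 !(phiD, phiN, phiM, phiX1, phiX2).
ring: mpC_iu2.
Qed.

Lemma dT_phi p : dT (phi p) = phi (x3 * p^`M(ix3)).
Proof. by have [_ _ h3] := phi_deriv p; rewrite /dT h3 phiM phiX3. Qed.

Section Ops.
Variables a b : K.
Local Notation A := (a%:MP_[3] : P).
Local Notation B := (b%:MP_[3] : P).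
Local Notation I := (iu%:MP_[3] : P).
Local Notation D1 p := (x1 * p^`M(ix1)).
Local Notation D2 p := (x2 * p^`M(ix2)).
Local Notation D3 p := (x3 * p^`M(ix3)).

(* The operators X_2 - i X_1, X_2 + i X_1 and X_3 on the scalars A /\ Y_i. *)
Definition Sz p := 2 * B * (D3 p - D2 p) + I * A * (D3 p - p).
Definition Sw p := 2 * B * (D3 p - D1 p) - I * A * (D3 p - p).
Definition S3 p := A * (D1 p + D2 p - 2 * p) - 2 * I * B * (D1 p - D2 p).

Definition phiE := (phiD, phiN, phiM, phiC, phiX1, phiX2, phiX3, phi2, phi1, phi0).
Definition mderivE := (mderivD, mderivN, mderivM, mderivC, mderivXU, mderiv2, mpolyC0).

(** [Wz] and [Ww] are the halves of Q1 + i Q2 and Q1 - i Q2. Multiplied by z' and z they become half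
    of g_1 + i g_2 and g_1 - i g_2, and the formula is X_1 g_1 + X_2 g_2 + X_3 g_3 written in these
    combinations. *)
Lemma d2_phi Wz Ww W3 :
  d2 a b (phi (Wz + Ww)) (phi (I * (Ww - Wz))) (phi W3) =
  - phi (I * (Sz (x1 * Ww) - Sw (x2 * Wz)) + S3 (x3 * W3)).
Proof.
have h1 : x1 * phi (Wz + Ww) + x2 * phi (I * (Ww - Wz)) = phi (x2 * Wz + x1 * Ww).
  by rewrite !phiE; ring: mpC_iu2.
have h2 : x2 * phi (Wz + Ww) - x1 * phi (I * (Ww - Wz)) = phi (I * (x2 * Wz - x1 * Ww)).
  by rewrite !phiE; ring: mpC_iu2.
rewrite /d2 h1 h2 !dT_phi !dE_phi !dJ_phi /Sz /Sw /S3 !mderivE /=.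
rewrite !phiE; gen_atoms; ring: mpC_iu2.
Qed.

(** [Uz], [Uw], [U3] are for the differential of a vector field what [Wz], [Ww], [W3] are for a
    bivector field; the factors z', z, x3 that would make them scalars are cancelled. *)
Definition Uz v3 vz := x1 * (2 * B * (D3 v3 - v3 - D2 v3) + I * A * (D3 v3 - v3))
  + I * x3 * (A * (D1 vz + D2 vz - vz) - 2 * I * B * (D1 vz - D2 vz - vz)).
Definition Uw v3 vw := x2 * (2 * B * (D3 v3 - v3 - D1 v3) - I * A * (D3 v3 - v3))
  - I * x3 * (A * (D1 vw + D2 vw - vw) - 2 * I * B * (D1 vw - D2 vw + vw)).
Definition U3 vz vw := - (x2 * (2 * B * (D3 vz + vz - D1 vz) - I * A * D3 vz)
  + x1 * (2 * B * (D3 vw + vw - D2 vw) + I * A * D3 vw)).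

(** For the vector field V of [d1_phi], z z' v3, z' x3 vz and z x3 vw are, up to a factor 2, V /\
    Y_12 and V /\ (Y_23 + i Y_31), V /\ (Y_23 - i Y_31). On them the differential has diagonal
    Koszul form, in this and the next two lemmas. *)
Lemma UzE v3 vz : x2 * Uz v3 vz = Sz (x1 * x2 * v3) + I * S3 (x2 * x3 * vz).
Proof. rewrite /Uz /Sz /S3 !mderivE /=; ring. Qed.
Lemma UwE v3 vw : x1 * Uw v3 vw = Sw (x1 * x2 * v3) - I * S3 (x1 * x3 * vw).
Proof. rewrite /Uw /Sw /S3 !mderivE /=; ring. Qed.
Lemma U3E vz vw : x3 * U3 vz vw = - (Sw (x2 * x3 * vz) + Sz (x1 * x3 * vw)).
Proof. rewrite /U3 /Sz /Sw !mderivE /=; ring. Qed.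

Lemma d1_phi vz vw v3 : let p1 := phi (vz + vw) in let p2 := phi (I * (vw - vz)) in
  let p3 := phi (2 * v3) in
  [/\ d1_1 a b p1 p2 p3 = phi (Uz v3 vz + Uw v3 vw),
      d1_2 a b p1 p2 p3 = phi (I * (Uw v3 vw - Uz v3 vz))
    & d1_3 a b p1 p2 p3 = phi (U3 vz vw)].
Proof.
rewrite /= /d1_1 /d1_2 /d1_3 !dT_phi !dE_phi !dJ_phi /Uz /Uw /U3 !mderivE /=.
rewrite !phiE; split; gen_atoms; ring: mpC_iu2.
Qed.
End Ops.
End Spectral.

(** * Eigenvalues on monomials and exactness of the small complexes *)

Section Coefficients.
Variable K : comNzRingType.
Implicit Types p : {mpoly K[3]}.

Lemma mcoeff_XM p i m :
  ('X_i * p)@_m = if m i == 0%N then 0 else p@_(m - U_(i))%MM.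
Proof.
case: eqP => [mi0|/eqP mi].
  rewrite mulrC mcoeffM big1 // => -[k1 k2] /= /eqP/mnmP/(_ i).
  rewrite mi0 mnmDE mcoeffX; case: eqP => [<-|_]; last by rewrite mulr0.
  by rewrite mnm1E eqxx addn1.
rewrite ['X_i * p]mulrC -(mcoeffMX p U_(i)%MM); congr (_ @__).
apply/mnmP => j; rewrite mnmDE mnmBE mnm1E subnKC //.
by case: eqP => [<-|//]; rewrite lt0n.
Qed.

Lemma mcoeff_XD p i m : ('X_i * p^`M(i))@_m = p@_m *+ m i.
Proof.
rewrite mcoeff_XM; case: eqP => [->|/eqP mi]; first by rewrite mulr0n.
rewrite mcoeff_mderiv mnmBE mnm1E eqxx subn1 prednK ?lt0n //.
congr (_@__ *+ _); apply/mnmP => j; rewrite mnmDE mnmBE mnm1E subnK //.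
by case: eqP => [<-|//]; rewrite lt0n.
Qed.
End Coefficients.

Section SpectralSymbols.
Variables (K : fieldType) (iu a b : K).
Implicit Types p : {mpoly K[3]}.

(** With [cw] and [c3]: the eigenvalues of X_2 - i X_1, X_2 + i X_1 and X_3 at the exponents lowered
    by one, which is the effect of the factor D. *)
Definition cz (m : 'X_{1..3}) : K :=
  2 * b * ((m ix3)%:R - (m ix2)%:R) + iu * a * ((m ix3)%:R - 1).
Definition cw (m : 'X_{1..3}) : K :=
  2 * b * ((m ix3)%:R - (m ix1)%:R) - iu * a * ((m ix3)%:R - 1).
Definition c3 (m : 'X_{1..3}) : K :=
  a * ((m ix1)%:R + (m ix2)%:R - 2) - 2 * iu * b * ((m ix1)%:R - (m ix2)%:R).

Lemma mcoeff_Sz p m : (Sz iu a b p)@_m = cz m * p@_m.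
Proof.
rewrite /Sz -mpolyCM -[2]/(1 *+ 2) -mpolyC1 -mpolyCMn -mpolyCM.
by rewrite !(mcoeffD, mcoeffN, mcoeffCM, mcoeff_XD) /cz;
  ring.
Qed.
Lemma mcoeff_Sw p m : (Sw iu a b p)@_m = cw m * p@_m.
Proof.
rewrite /Sw -mpolyCM -[2]/(1 *+ 2) -mpolyC1 -mpolyCMn -mpolyCM.
by rewrite !(mcoeffD, mcoeffN, mcoeffCM, mcoeff_XD) /cw;
  ring.
Qed.
Lemma mcoeff_S3 p m : (S3 iu a b p)@_m = c3 m * p@_m.
Proof.
rewrite /S3 -[2]/(1 *+ 2) -mpolyC1 -mpolyCMn -!mpolyCM.
by rewrite !(mcoeffD, mcoeffN, mcoeffCM, mcoeff_XD) /c3;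
  ring.
Qed.

End SpectralSymbols.

Section MonomialAlgebra.
Variables (K : fieldType) (iu cz cw c3 Gz Gw g3 : K).
Hypotheses (iu2 : iu * iu = -1)
  (closed : iu * (cz * Gw - cw * Gz) + c3 * g3 = 0).

Lemma closed_eq : cz * Gw = cw * Gz + iu * c3 * g3.
Proof.
apply: subr0_eq; transitivity (- iu * (iu * (cz * Gw - cw * Gz) + c3 * g3)).
  by ring: iu2.
by rewrite closed mulr0.
Qed.

(** Koszul contraction by an invertible scalar, normalized by [Hz] = 0. The explicit solution is
    exported because the no-pole conditions are later read off from it. *)
Lemma primitive_cz : cz != 0 -> exists h Hz Hw,
  [/\ Gz = cz * h + iu * (c3 * Hz), Gw = cw * h - iu * (c3 * Hw)
    & g3 = - (cw * Hz + cz * Hw)] /\ [/\ h = Gz / cz, Hz = 0 & Hw = - g3 / cz].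
Proof.
move=> n0; exists (Gz / cz), 0, (- g3 / cz); split; split=> //; first by field.
  by apply: (mulfI n0); rewrite closed_eq; field.
by field.
Qed.

Lemma primitive_cw : cw != 0 -> exists h Hz Hw,
  [/\ Gz = cz * h + iu * (c3 * Hz), Gw = cw * h - iu * (c3 * Hw)
    & g3 = - (cw * Hz + cz * Hw)] /\ [/\ h = Gw / cw, Hz = - g3 / cw & Hw = 0].
Proof.
move=> n0; exists (Gw / cw), (- g3 / cw), 0; split; split=> //; try by field.
have h : cw * Gz = cz * Gw - iu * c3 * g3 by rewrite closed_eq; ring.
by apply: (mulfI n0); rewrite h; field.
Qed.

Lemma primitive_c3 : c3 != 0 -> exists h Hz Hw,
  [/\ Gz = cz * h + iu * (c3 * Hz), Gw = cw * h - iu * (c3 * Hw)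
    & g3 = - (cw * Hz + cz * Hw)] /\ [/\ h = 0,
        Hz = - iu * Gz / c3 & Hw = iu * Gw / c3].
Proof.
move=> n0; exists 0, (- iu * Gz / c3), (iu * Gw / c3); split; split=> //.
- transitivity (- (iu * iu) * Gz); first by rewrite iu2; ring.
  by field.
- transitivity (- (iu * iu) * Gw); first by rewrite iu2; ring.
  by field.
- apply: (mulfI n0); transitivity (- (iu * (cz * Gw - cw * Gz))).
    by apply/eqP; rewrite -subr_eq0 opprK addrC closed.
  by field.
Qed.
End MonomialAlgebra.

Section Complex.
Variables (R : realType) (K : fieldType) (rc : {rmorphism R -> K}) (iu : K).
Hypothesis iu2 : iu * iu = -1.
Hypothesis reim_eq0 : forall u v : R, rc u + iu * rc v = 0 -> u = 0 /\ v = 0.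

Variables a b : R.
Hypothesis b0 : b != 0.
Local Notation aC := (rc a).
Local Notation bC := (rc b).

(* Exponents of the monomials at which the small complex is not exact. *)
Definition bad (m : 'X_{1..3}) : Prop :=
  [\/ [/\ (0 < m ix3)%N, m ix1 = m ix3, m ix2 = m ix3 & a = 0 \/ m ix3 = 1%N],
      [/\ a = 0, m ix1 = 0%N, (0 < m ix2)%N & m ix3 = 0%N],
      [/\ a = 0, m ix2 = 0%N, (0 < m ix1)%N & m ix3 = 0%N] |
      [/\ a = 0, m ix1 = 0%N, m ix2 = 0%N & (0 < m ix3)%N]].

Local Notation cz := (cz iu aC bC).
Local Notation cw := (cw iu aC bC).
Local Notation c3 := (c3 iu aC bC).

Lemma natr_real_eq (i j : nat) : (i%:R - j%:R = 0 :> R) -> i = j.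
Proof. by move/eqP; rewrite subr_eq0 eqr_nat => /eqP. Qed.

(** Real and imaginary parts vanish separately: 2b (ga - be) = 0, where b != 0, and a (ga - 1) =
    0. *)
Lemma cz_eq0 m : cz m = 0 -> m ix2 = m ix3 /\ (a = 0 \/ m ix3 = 1%N).
Proof.
move=> h; have [|h1 h2] := @reim_eq0 (2 * b * ((m ix3)%:R - (m ix2)%:R)) (a * ((m
    ix3)%:R - 1)).
  by rewrite -[RHS]h /cz !(rmorphM, rmorphB, rmorph_nat, rmorph1) /=; ring.
move/eqP: h1; rewrite !mulf_eq0 (negbTE b0) pnatr_eq0 /= => /eqP/natr_real_eq h1.
move/eqP: h2; rewrite mulf_eq0 subr_eq0 pnatr_eq1.
by case/orP=> /eqP h2; split; auto.
Qed.

Lemma cw_eq0 m : cw m = 0 -> m ix1 = m ix3 /\ (a = 0 \/ m ix3 = 1%N).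
Proof.
move=> h; have [|h1 h2] := @reim_eq0 (2 * b * ((m ix3)%:R - (m ix1)%:R)) (- (a * ((m
    ix3)%:R - 1))).
  by rewrite -[RHS]h /cw !(rmorphM, rmorphB, rmorphN, rmorph_nat, rmorph1) /=; ring.
move/eqP: h1; rewrite !mulf_eq0 (negbTE b0) pnatr_eq0 /= => /eqP/natr_real_eq h1.
move/eqP: h2; rewrite oppr_eq0 mulf_eq0 subr_eq0 pnatr_eq1.
by case/orP=> /eqP h2; split; auto.
Qed.

Lemma c3_eq0 m : c3 m = 0 -> m ix1 = m ix2 /\ (a = 0 \/ m ix1 = 1%N).
Proof.
move=> h; have [|h1 h2] := @reim_eq0 (a * ((m ix1)%:R + (m ix2)%:R - 2)) (- (2 * b *
    ((m ix1)%:R - (m ix2)%:R))).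
  by rewrite -[RHS]h /c3 !(rmorphM, rmorphB, rmorphD, rmorphN, rmorph_nat, rmorph1) /=;
      ring.
move/eqP: h2; rewrite oppr_eq0 !mulf_eq0 (negbTE b0) pnatr_eq0 /= => /eqP/natr_real_eq
    h2.
move/eqP: h1; rewrite mulf_eq0 h2 -mulr2n -mulrnBl mulrn_eq0 subr_eq0 pnatr_eq1 /=.
by case/orP=> /eqP h1; split; auto; right; rewrite h2.
Qed.

(** Dividing by [cz] is safe when al > 0: [h] = Gz / cz vanishes at be = 0 because [Gz] does, and
    [Hw] = - g3 / cz vanishes at ga = 0 because [g3] does. In the same way [cw] needs be > 0 and
    [c3] needs ga > 0. The last clause, zero data giving the zero primitive, keeps supports finite
    when monomials are reassembled. *)
Lemma monomial_primitive (m : 'X_{1..3}) (Gz Gw g3 : K) :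
  (m ix2 = 0%N -> Gz = 0) -> (m ix1 = 0%N -> Gw = 0) -> (m ix3 = 0%N -> g3 = 0) ->
  iu * (cz m * Gw - cw m * Gz) + c3 m * g3 = 0 ->
  (bad m -> [/\ Gz = 0, Gw = 0 & g3 = 0]) ->
  exists h Hz Hw, [/\ [/\ Gz = cz m * h + iu * (c3 m * Hz),
      Gw = cw m * h - iu * (c3 m * Hw) & g3 = - (cw m * Hz + cz m * Hw)],
     m ix1 = 0%N \/ m ix2 = 0%N -> h = 0,
     m ix2 = 0%N \/ m ix3 = 0%N -> Hz = 0,
     m ix1 = 0%N \/ m ix3 = 0%N -> Hw = 0 &
     [/\ Gz = 0, Gw = 0 & g3 = 0] -> [/\ h = 0, Hz = 0 & Hw = 0]].
Proof.
move=> hz hw h3 hc hb.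
have zero_case : Gz = 0 -> Gw = 0 -> g3 = 0 -> exists h Hz Hw : K,
    [/\ [/\ Gz = cz m * h + iu * (c3 m * Hz),
      Gw = cw m * h - iu * (c3 m * Hw) & g3 = - (cw m * Hz + cz m * Hw)],
     m ix1 = 0%N \/ m ix2 = 0%N -> h = 0,
     m ix2 = 0%N \/ m ix3 = 0%N -> Hz = 0,
     m ix1 = 0%N \/ m ix3 = 0%N -> Hw = 0 &
     [/\ Gz = 0, Gw = 0 & g3 = 0] -> [/\ h = 0, Hz = 0 & Hw = 0]].
  by move=> -> -> ->; exists 0, 0, 0; rewrite !(mulr0, addr0, subr0, oppr0); split.
have [czm|czm] := boolP ((m ix1 == 0%N) || (cz m == 0)); last first.
  move: czm; rewrite negb_or => /andP[/eqP m1 /(primitive_cz iu2 hc)].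
  move=> [h [Hz [Hw [E [hE HzE HwE]]]]]; subst h Hz Hw.
  do 3![eexists]; split; [exact: E| | | |] => //.
  - by case=> // /hz ->; rewrite mul0r.
  - by case=> // /h3 ->; rewrite oppr0 mul0r.
  - by case=> -> _ ->; rewrite oppr0 !mul0r.
have [cwm|cwm] := boolP ((m ix2 == 0%N) || (cw m == 0)); last first.
  move: cwm; rewrite negb_or => /andP[/eqP m1 /(primitive_cw iu2 hc)].
  move=> [h [Hz [Hw [E [hE HzE HwE]]]]]; subst h Hz Hw.
  do 3![eexists]; split; [exact: E| | | |] => //.
  - by case=> // /hw ->; rewrite mul0r.
  - by case=> // /h3 ->; rewrite oppr0 mul0r.
  - by case=> _ -> ->; rewrite oppr0 !mul0r.
have [c3m|c3m] := boolP ((m ix3 == 0%N) || (c3 m == 0)); last first.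
  move: c3m; rewrite negb_or => /andP[/eqP m1 /(primitive_c3 iu2 hc)].
  move=> [h [Hz [Hw [E [hE HzE HwE]]]]]; subst h Hz Hw.
  do 3![eexists]; split; [exact: E| | | |] => //.
  - by case=> // /hz ->; rewrite mulr0 mul0r.
  - by case=> // /hw ->; rewrite mulr0 mul0r.
  - by case=> -> -> _; rewrite !mulr0 !mul0r.
(* No safe division is left. At al = be = ga = 0 the no-pole conditions kill all data; everywhere
   else the vanishing scalars force [m] onto the list of exceptional monomials. *)
suff [/hb[]|[]] : bad m \/ [/\ Gz = 0, Gw = 0 & g3 = 0] by apply: zero_case.
have [m1|m1] := posnP (m ix1); have [m2|m2] := posnP (m ix2).
- have [m3|m3] := posnP (m ix3); first by right; split; [apply: hz|apply: hw|apply: h3].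
  move: c3m; rewrite eqn0Ngt m3 /= => /eqP/c3_eq0[_]; rewrite m1 => -[a0|//].
  by left; apply: Or44.
- move: cwm; rewrite eqn0Ngt m2 /= => /eqP/cw_eq0[m3 [a0|h]];
    last by rewrite m1 h in m3.
  by left; apply: Or42; rewrite -m3.
- move: czm; rewrite eqn0Ngt m1 /= => /eqP/cz_eq0[m3 [a0|h]];
    last by rewrite m2 h in m3.
  by left; apply: Or43; rewrite -m3.
- move: czm cwm; rewrite !eqn0Ngt m1 m2 /= => /eqP/cz_eq0[m23 a0] /eqP/cw_eq0[m13 _].
  by left; apply: Or41; split=> //; rewrite -m13.
Qed.

(** At a diagonal exceptional monomial all three scalars are zero. At a pure power of z, z' or x3
    each of [h], [Hz], [Hw] would have a pole, hence is zero. *)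
Lemma monomial_exact (m : 'X_{1..3}) (Gz Gw g3 h Hz Hw : K) :
  Gz = cz m * h + iu * (c3 m * Hz) -> Gw = cw m * h - iu * (c3 m * Hw) ->
  g3 = - (cw m * Hz + cz m * Hw) ->
  (m ix1 = 0%N \/ m ix2 = 0%N -> h = 0) ->
  (m ix2 = 0%N \/ m ix3 = 0%N -> Hz = 0) ->
  (m ix1 = 0%N \/ m ix3 = 0%N -> Hw = 0) ->
  bad m -> [/\ Gz = 0, Gw = 0 & g3 = 0].
Proof.
move=> -> -> -> h12 h23 h13 [[m3 m1 m2 a1]|[_ m1 _ m3]|[_ m2 _ m3]|[_ m1 m2 _]].
- have e1 : aC * ((m ix3)%:R - 1) = 0.
    by case: a1 => ->; rewrite ?rmorph0 ?subrr ?mulr0 ?mul0r.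
  have e2 : aC * ((m ix3)%:R + (m ix3)%:R - 2) = 0.
    by case: a1 => ->; rewrite ?rmorph0 ?subrr ?mulr0 ?mul0r.
  rewrite /cz /cw /c3 m1 m2 !subrr !mulr0 -!mulrA e1 e2.
  by rewrite !(mulr0, mul0r, oppr0, addr0, subr0).
- by rewrite h12 ?h23 ?h13; auto; rewrite !(mulr0, addr0, subr0, oppr0).
- by rewrite h12 ?h23 ?h13; auto; rewrite !(mulr0, addr0, subr0, oppr0).
- by rewrite h12 ?h23 ?h13; auto; rewrite !(mulr0, addr0, subr0, oppr0).
Qed.
End Complex.

(** * Polynomial primitives from monomial ones *)

Section MkPoly.
Variable K : comNzRingType.
Implicit Types f : 'X_{1..3} -> K.

Lemma mpoly_of_fun N f : (forall m : 'X_{1..3}, (N <= mdeg m)%N -> f m = 0) ->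
  exists p : {mpoly K[3]}, forall m, p@_m = f m.
Proof.
move=> fN; exists (\sum_(m : 'X_{1..3 < N}) f m *: 'X_[m]) => m.
have [mN|mN] := ltnP (mdeg m) N; first exact: mcoeff_mpoly.
rewrite fN // raddf_sum big1 // => k _ /=; rewrite mcoeffZ mcoeffX.
case: eqP => [h|_]; last by rewrite mulr0.
by move: mN; rewrite -h leqNgt bmdeg.
Qed.

(** The no-pole conditions say that the family is that of a multiple of x_i x_j; the quotient is
    obtained by shifting exponents. *)
Lemma mpoly_of_fun_div N f (i j : 'I_3) : i != j ->
  (forall m : 'X_{1..3}, (N <= mdeg m)%N -> f m = 0) ->
  (forall m : 'X_{1..3}, m i = 0%N \/ m j = 0%N -> f m = 0) ->
  exists p : {mpoly K[3]}, forall m, ('X_i * 'X_j * p)@_m = f m.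
Proof.
move=> ij fN f0; have [|p pE] := @mpoly_of_fun N (fun m => f (m + (U_(i) + U_(j)))%MM).
  by move=> m mN; apply: fN; rewrite mdegD (leq_trans mN) ?leq_addr.
exists p => m; rewrite -mulrA !mcoeff_XM mnmBE mnm1E (negbTE ij) subn0.
case: eqP => [mi|/eqP mi]; first by rewrite f0 //; left.
case: eqP => [mj|/eqP mj]; first by rewrite f0 //; right.
rewrite pE; congr f; apply/mnmP => k; rewrite !(mnmDE, mnmBE, mnm1E) -subnDA subnK //.
case: eqP => [<-|_]; first by rewrite eq_sym (negbTE ij) addn0 lt0n.
by case: eqP => [<-|_]; rewrite ?lt0n.
Qed.

Lemma mcoeff_msize (p : {mpoly K[3]}) m : (msize p <= mdeg m)%N -> p@_m = 0.
Proof. by move=> h; apply: memN_msupp_eq0; apply/negP => /msize_mdeg_lt;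
    rewrite ltnNge h. Qed.
End MkPoly.

Section Primitive.
Variables (K : fieldType) (iu a b : K) (bad : 'X_{1..3} -> Prop).
Local Notation P := {mpoly K[3]}.
Local Notation I := (iu%:MP_[3] : P).
Local Notation cz := (cz iu a b).
Local Notation cw := (cw iu a b).
Local Notation c3 := (c3 iu a b).
Local Notation Uz := (Uz iu a b).
Local Notation Uw := (Uw iu a b).
Local Notation U3 := (U3 iu a b).
Local Notation Sz := (Sz iu a b).
Local Notation Sw := (Sw iu a b).
Local Notation S3 := (S3 iu a b).

Hypotheses (iu2 : iu * iu = -1) (two_neq0 : 2 != 0 :> K).
Hypothesis monomial_primitive : forall (m : 'X_{1..3}) (Gz Gw g3 : K),
  (m ix2 = 0%N -> Gz = 0) -> (m ix1 = 0%N -> Gw = 0) -> (m ix3 = 0%N -> g3 = 0) ->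
  iu * (cz m * Gw - cw m * Gz) + c3 m * g3 = 0 ->
  (bad m -> [/\ Gz = 0, Gw = 0 & g3 = 0]) ->
  exists h Hz Hw, [/\ [/\ Gz = cz m * h + iu * (c3 m * Hz),
      Gw = cw m * h - iu * (c3 m * Hw) & g3 = - (cw m * Hz + cz m * Hw)],
     m ix1 = 0%N \/ m ix2 = 0%N -> h = 0,
     m ix2 = 0%N \/ m ix3 = 0%N -> Hz = 0,
     m ix1 = 0%N \/ m ix3 = 0%N -> Hw = 0 &
     [/\ Gz = 0, Gw = 0 & g3 = 0] -> [/\ h = 0, Hz = 0 & Hw = 0]].
Hypothesis monomial_exact : forall (m : 'X_{1..3}) (Gz Gw g3 h Hz Hw : K),
  Gz = cz m * h + iu * (c3 m * Hz) -> Gw = cw m * h - iu * (c3 m * Hw) ->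
  g3 = - (cw m * Hz + cz m * Hw) ->
  (m ix1 = 0%N \/ m ix2 = 0%N -> h = 0) ->
  (m ix2 = 0%N \/ m ix3 = 0%N -> Hz = 0) ->
  (m ix1 = 0%N \/ m ix3 = 0%N -> Hw = 0) ->
  bad m -> [/\ Gz = 0, Gw = 0 & g3 = 0].

Lemma mpolyX_neq0 (i : 'I_3) : 'X_i != 0 :> P.
Proof. by apply/eqP => /mpolyP/(_ U_(i)%MM)/eqP;
    rewrite mcoeffXU mcoeff0 eqxx oner_eq0. Qed.

(** A primitive is chosen for each monomial. The resulting equations are those of [UzE], [UwE],
    [U3E], from which z', z and x3 can be cancelled. *)
Lemma spectral_primitive (Wz Ww W3 : P) :
  I * (Sz (x1 * Ww) - Sw (x2 * Wz)) + S3 (x3 * W3) = 0 ->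
  (forall m, bad m ->
     [/\ (x2 * Wz)@_m = 0, (x1 * Ww)@_m = 0 & (x3 * W3)@_m = 0]) ->
  exists v3 vz vw, [/\ Uz v3 vz = Wz, Uw v3 vw = Ww & U3 vz vw = W3].
Proof.
move=> closed bad0.
have H m : exists y : K * K * K,
  [/\ [/\ (x2 * Wz)@_m = cz m * y.1.1 + iu * (c3 m * y.1.2),
      (x1 * Ww)@_m = cw m * y.1.1 - iu * (c3 m * y.2)
     & (x3 * W3)@_m = - (cw m * y.1.2 + cz m * y.2)],
     m ix1 = 0%N \/ m ix2 = 0%N -> y.1.1 = 0,
     m ix2 = 0%N \/ m ix3 = 0%N -> y.1.2 = 0,
     m ix1 = 0%N \/ m ix3 = 0%N -> y.2 = 0 &
     [/\ (x2 * Wz)@_m = 0, (x1 * Ww)@_m = 0 & (x3 * W3)@_m = 0] ->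
       [/\ y.1.1 = 0, y.1.2 = 0 & y.2 = 0]].
  have [] := @monomial_primitive m _ _ _ _ _ _ _ (bad0 m).
  - by rewrite mcoeff_XM => ->.
  - by rewrite mcoeff_XM => ->.
  - by rewrite mcoeff_XM => ->.
  - move/mpolyP: closed => /(_ m).
    by rewrite mcoeffD mcoeffCM mcoeffB mcoeff_Sz mcoeff_Sw mcoeff_S3 mcoeff0.
  by move=> h [Hz [Hw ?]]; exists (h, Hz, Hw).
have {H} [y yP] := boolp.choice H.
(* From degree [N] on the data vanish, hence so do the chosen primitives: they assemble to
   polynomials. *)
pose N := maxn (msize (x2 * Wz)) (maxn (msize (x1 * Ww)) (msize (x3 * W3))).
have yN (m : 'X_{1..3}) : (N <= mdeg m)%N -> [/\ (y m).1.1 = 0,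
    (y m).1.2 = 0 & (y m).2 = 0].
  rewrite !geq_max => /and3P[n1 n2 n3]; case: (yP m) => _ _ _ _; apply.
  by split; apply: mcoeff_msize.
have [||v3 v3E] := @mpoly_of_fun_div _ N (fun m => (y m).1.1) ix1 ix2 isT.
- by move=> m /yN[].
- by move=> m; case: (yP m).
have [||vz vzE] := @mpoly_of_fun_div _ N (fun m => (y m).1.2) ix2 ix3 isT.
- by move=> m /yN[].
- by move=> m; case: (yP m).
have [||vw vwE] := @mpoly_of_fun_div _ N (fun m => (y m).2) ix1 ix3 isT.
- by move=> m /yN[].
- by move=> m; case: (yP m).
exists v3, vz, vw; split.
- apply: (mulfI (mpolyX_neq0 ix2)); rewrite UzE; apply/mpolyP => m.
  case: (yP m) => -[-> _ _] _ _ _ _.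
  by rewrite mcoeffD mcoeffCM mcoeff_Sz mcoeff_S3 v3E vzE.
- apply: (mulfI (mpolyX_neq0 ix1)); rewrite UwE; apply/mpolyP => m.
  case: (yP m) => -[_ -> _] _ _ _ _.
  by rewrite mcoeffB mcoeffCM mcoeff_Sw mcoeff_S3 v3E vwE.
- apply: (mulfI (mpolyX_neq0 ix3)); rewrite U3E; apply/mpolyP => m.
  case: (yP m) => -[_ _ ->] _ _ _ _.
  rewrite mcoeffN mcoeffD; congr (- (_ + _)).
    by rewrite mcoeff_Sw vzE.
  by rewrite mcoeff_Sz vwE.
Qed.

Lemma spectral_exact (v3 vz vw : P) m : bad m ->
  [/\ (x2 * Uz v3 vz)@_m = 0, (x1 * Uw v3 vw)@_m = 0 & (x3 * U3 vz vw)@_m = 0].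
Proof.
rewrite UzE UwE U3E !(mcoeffD, mcoeffN, mcoeffCM, mcoeff_Sz, mcoeff_Sw, mcoeff_S3).
apply: monomial_exact => //; rewrite -!mulrA !mcoeff_XM ?mnmBE ?mnm1E.
- by case=> ->; rewrite ?subn0 ?eqxx //; case: ifP.
- by case=> ->; rewrite ?subn0 ?eqxx //; case: ifP.
- by case=> ->; rewrite ?subn0 ?eqxx //; case: ifP.
Qed.

Local Notation phi := (phi iu).
Local Notation psi := (psi iu).

(* With g_i the scalar A /\ Y_i, these are g_1 + i g_2, g_1 - i g_2 and g_3 in the
   variables z, z', x3. *)
Definition Gz (Q1 Q2 : P) := x2 * psi (Q1 + I * Q2).
Definition Gw (Q1 Q2 : P) := x1 * psi (Q1 - I * Q2).
Definition G3 (Q3 : P) := x3 * psi Q3.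
(** For a closed triple this is equivalent to being a coboundary, by [complex_primitive] and
    [complex_exact]. *)
Definition classes_vanish (Q1 Q2 Q3 : P) := forall m, bad m ->
  [/\ (Gz Q1 Q2)@_m = 0, (Gw Q1 Q2)@_m = 0 & (G3 Q3)@_m = 0].

Let hf : P := (2^-1)%:MP.
Lemma half_iu : 2 * hf = 1. Proof. exact: (mpC_half two_neq0). Qed.
Let hI : I * I = -1. Proof. exact: (mpC_iu2 iu2). Qed.
Let phiK := phiK iu2 two_neq0.
Let psiK := psiK iu2 two_neq0.

Lemma complex_primitive (Q1 Q2 Q3 : P) :
  d2 a b Q1 Q2 Q3 = 0 -> classes_vanish Q1 Q2 Q3 ->
  exists p1 p2 p3 : P, [/\ d1_1 a b p1 p2 p3 = Q1, d1_2 a b p1 p2 p3 = Q2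
    & d1_3 a b p1 p2 p3 = Q3].
Proof.
move=> closed vanish.
pose Wz := hf * psi (Q1 + I * Q2); pose Ww := hf * psi (Q1 - I * Q2).
have E1 : phi (Wz + Ww) = Q1.
  rewrite -[RHS]psiK; congr (phi _); rewrite /Wz /Ww !(psiD, psiN).
  ring: half_iu.
have E2 : phi (I * (Ww - Wz)) = Q2.
  rewrite -[RHS]psiK; congr (phi _); rewrite /Wz /Ww !(psiD, psiN, psiM, psiC).
  ring: half_iu hI.
have E3 : phi (psi Q3) = Q3 by exact: psiK.
have := d2_phi iu2 a b Wz Ww (psi Q3).
rewrite E1 E2 E3 closed => /esym/eqP; rewrite oppr_eq0 => /eqP/(congr1 psi).
rewrite phiK psi0 => closed'.
have [|v3 [vz [vw [Ez Ew e3]]]] := spectral_primitive closed'.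
  move=> m /vanish[h1 h2 h3]; split=> //.
    by rewrite mulrCA mcoeffCM -/(Gz Q1 Q2) h1 mulr0.
  by rewrite mulrCA mcoeffCM -/(Gw Q1 Q2) h2 mulr0.
have /= [h1 h2 h3] := d1_phi iu2 a b vz vw v3.
exists (phi (vz + vw)), (phi (I * (vw - vz))), (phi (2 * v3)).
by rewrite h1 h2 h3 Ez Ew e3.
Qed.

Lemma complex_exact (p1 p2 p3 : P) :
  classes_vanish (d1_1 a b p1 p2 p3) (d1_2 a b p1 p2 p3) (d1_3 a b p1 p2 p3).
Proof.
pose vz := hf * psi (p1 + I * p2); pose vw := hf * psi (p1 - I * p2).
pose v3 := hf * psi p3.
have E1 : phi (vz + vw) = p1.
  rewrite -[RHS]psiK; congr (phi _); rewrite /vz /vw !(psiD, psiN).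
  ring: half_iu.
have E2 : phi (I * (vw - vz)) = p2.
  rewrite -[RHS]psiK; congr (phi _); rewrite /vz /vw !(psiD, psiN, psiM, psiC).
  ring: half_iu hI.
have E3 : phi (2 * v3) = p3.
  by rewrite -[RHS]psiK; congr (phi _); rewrite /v3 mulrA half_iu mul1r.
have /= [h1 h2 h3] := d1_phi iu2 a b vz vw v3.
rewrite E1 E2 E3 in h1 h2 h3; rewrite /classes_vanish /Gz /Gw /G3 h1 h2 h3 => m badm.
have [e1 e2 e3] := spectral_exact v3 vz vw badm.
split; rewrite ?(psiD, psiN, psiM, psiC) !phiK;
    [rewrite -[RHS](mul0rn _ 2) -e1|rewrite -[RHS](mul0rn _ 2) -e2|exact: e3];
  rewrite -mcoeffMn -mulrnAr; congr (_ * _)@__; ring: hI.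
Qed.
End Primitive.

(** * Descent from complex to real coefficients *)

Lemma map_mpoly_deriv (A B : nzRingType) (f : {additive A -> B}) i (p : {mpoly A[3]}) :
  map_mpoly f p^`M(i) = (map_mpoly f p)^`M(i).
Proof. by apply/mpolyP => m; rewrite mcoeff_map_mpoly !mcoeff_mderiv mcoeff_map_mpoly
    raddfMn. Qed.

Section Triples.
Variables (K : comNzRingType).
Local Notation P := {mpoly K[3]}.
Local Notation T := (P * P * P)%type.
Variables a b : K.

Definition d2t (q : T) : P := d2 a b q.1.1 q.1.2 q.2.
Definition d1t (p : T) : T :=
  (d1_1 a b p.1.1 p.1.2 p.2, d1_2 a b p.1.1 p.1.2 p.2, d1_3 a b p.1.1 p.1.2 p.2).

Lemma d2t_is_linear : linear d2t.
Proof.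
move=> c [[p1 p2] p3] [[q1 q2] q3] /=;
    rewrite /d2t /d2 /dE /dJ /dT /= -!mul_mpolyC !mderivE.
ring.
Qed.
HB.instance Definition _ := GRing.isLinear.Build K T P _ d2t d2t_is_linear.

Lemma d1t_is_linear : linear d1t.
Proof.
move=> c [[p1 p2] p3] [[q1 q2] q3] /=; rewrite /d1t /d1_1 /d1_2 /d1_3 /dE /dJ /dT /=.
by congr (_, _, _) => /=; rewrite -!mul_mpolyC !mderivE; ring.
Qed.
HB.instance Definition _ := GRing.isLinear.Build K T T _ d1t d1t_is_linear.
End Triples.

Section ChangeOfRing.
Variables (A B : comNzRingType) (f : {rmorphism A -> B}) (a b : A).
Local Notation PA := {mpoly A[3]}.
Local Notation PB := {mpoly B[3]}.

Definition fmap (p : PA) : PB := map_mpoly f p.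
Lemma fmap0 : fmap 0 = 0. Proof. exact: raddf0. Qed.
Lemma fmapD : {morph fmap : p q / p + q}. Proof. exact: raddfD. Qed.
Lemma fmapN : {morph fmap : p / - p}. Proof. exact: raddfN. Qed.
Lemma fmapM : {morph fmap : p q / p * q}. Proof. exact: rmorphM. Qed.
Lemma fmapX i : fmap 'X_i = 'X_i. Proof. exact: map_mpolyX. Qed.
Lemma fmapC c : fmap c%:MP = (f c)%:MP. Proof. exact: map_mpolyC. Qed.
Lemma fmap2 : fmap 2 = 2. Proof. exact: rmorph_nat. Qed.
Lemma fmap_deriv i p : fmap p^`M(i) = (fmap p)^`M(i).
Proof. exact: map_mpoly_deriv. Qed.

Definition map3 (t : PA * PA * PA) : PB * PB * PB :=
  (fmap t.1.1, fmap t.1.2, fmap t.2).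

Lemma d2t_map3 q : d2t (f a) (f b) (map3 q) = fmap (d2t a b q).
Proof.
case: q => [[q1 q2] q3]; rewrite /d2t /map3 /= /d2 /dE /dJ /dT.
by rewrite !(fmapD, fmapN, fmapM, fmapX, fmapC, fmap2, fmap_deriv).
Qed.

Lemma d1t_map3 q : d1t (f a) (f b) (map3 q) = map3 (d1t a b q).
Proof.
case: q => [[p1 p2] p3]; rewrite /d1t /map3 /= /d1_1 /d1_2 /d1_3 /dE /dJ /dT.
by congr (_, _, _); rewrite !(fmapD, fmapN, fmapM, fmapX, fmapC, fmap2, fmap_deriv).
Qed.
End ChangeOfRing.

Section RealPart.
Variables (R : realType) (K : fieldType) (rc : {rmorphism R -> K})
  (re im : {additive K -> R}) (iu : K).
Hypothesis iu2 : iu * iu = -1.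
Hypothesis reim : forall z, z = rc (re z) + iu * rc (im z).
Hypothesis re_rc : forall z x, re (z * rc x) = re z * x.
Hypothesis re1 : re 1 = 1.
Hypothesis reiu : re iu = 0.
Local Notation T K := ({mpoly K[3]} * {mpoly K[3]} * {mpoly K[3]})%type.

Lemma reim_eq0 (u v : R) : rc u + iu * rc v = 0 -> u = 0 /\ v = 0.
Proof.
move=> h; have u0 : u = 0.
  move: (congr1 re h).
  by rewrite raddfD -[rc u]mul1r !re_rc re1 reiu mul1r mul0r addr0 raddf0.
split=> //; apply/eqP; rewrite -(fmorph_eq0 rc); apply/eqP.
transitivity (- iu * (rc u + iu * rc v)); last by rewrite h mulr0.
by rewrite u0 rmorph0; ring: iu2.
Qed.

Lemma two_neq0 : 2 != 0 :> K.
Proof. by rewrite -(rmorph_nat rc) fmorph_eq0 pnatr_eq0. Qed.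

Local Notation ReP := (map_mpoly re).
Local Notation toC := (fmap rc).
Local Notation toC3 := (map3 rc).

Definition re3 (t : T K) : T R := (ReP t.1.1, ReP t.1.2, ReP t.2).

Variables a b : R.

Lemma toC3_d2t q : d2t (rc a) (rc b) (toC3 q) = toC (d2t a b q).
Proof. exact: (d2t_map3 rc). Qed.

Lemma re3D : {morph re3 : s t / s + t}.
Proof. by move=> s t; rewrite /re3 /= !raddfD. Qed.
Lemma re3N : {morph re3 : s / - s}.
Proof. by move=> s; rewrite /re3 /= !raddfN. Qed.
Lemma re3_toC3 c t : re3 (c *: toC3 t) = re c *: t.
Proof.
case: t => [[t1 t2] t3]; congr (_, _, _); apply/mpolyP => m;
by rewrite mcoeff_map_mpoly /= !mcoeffZ mcoeff_map_mpoly; exact: re_rc.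
Qed.

Definition im3 (t : T K) : T R :=
  (map_mpoly im t.1.1, map_mpoly im t.1.2, map_mpoly im t.2).

Lemma re3_im3 t : t = toC3 (re3 t) + iu *: toC3 (im3 t).
Proof.
case: t => [[t1 t2] t3]; congr (_, _, _); apply/mpolyP => m;
  by rewrite mcoeffD mcoeffZ /= !mcoeff_map_mpoly /= -reim.
Qed.

Lemma toC3_d1t p : d1t (rc a) (rc b) (toC3 p) = toC3 (d1t a b p).
Proof. exact: (d1t_map3 rc). Qed.

Lemma re3_d1t p : re3 (d1t (rc a) (rc b) p) = d1t a b (re3 p).
Proof.
rewrite {1}[p]re3_im3 linearD linearZ /= !toC3_d1t re3D re3_toC3 reiu scale0r addr0.
by rewrite -[toC3 _]scale1r re3_toC3 re1 scale1r.
Qed.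

Definition vanish3 (t : T K) : Prop :=
  classes_vanish (iu) (bad a) t.1.1 t.1.2 t.2.

Hypothesis b0 : b != 0.

(** The differential has real coefficients, so it commutes with real parts. As [q] and the [e i] are
    real, taking the real part only replaces [c i] by [re (c i)]. *)
Lemma real_primitive n (q : T R) (e : 'I_n -> T R) (c : 'I_n -> K) :
  d2t a b q = 0 -> (forall i, d2t a b (e i) = 0) ->
  vanish3 (toC3 q - \sum_(i < n) c i *: toC3 (e i)) ->
  exists p : T R, d1t a b p = q - \sum_(i < n) re (c i) *: e i.
Proof.
move=> dq de van.
have closed : d2t (rc a) (rc b) (toC3 q - \sum_(i < n) c i *: toC3 (e i)) = 0.
  rewrite linearB linear_sum /= toC3_d2t dq fmap0 big1 ?subr0 // => i _.
  by rewrite linearZ /= toC3_d2t de fmap0 scaler0.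
have [p1 [p2 [p3 [h1 h2 h3]]]] := complex_primitive iu2 two_neq0
  (monomial_primitive iu2 reim_eq0 b0) closed van.
exists (re3 (p1, p2, p3)); rewrite -re3_d1t /d1t /= h1 h2 h3.
rewrite -!surjective_pairing re3D re3N; congr (_ - _).
  by rewrite -[toC3 q]scale1r re3_toC3 re1 scale1r.
elim/big_rec2: _ => [|i s t _ <-]; first by rewrite /re3 /= !raddf0.
by rewrite re3D re3_toC3.
Qed.

Lemma real_exact (p : T R) : vanish3 (toC3 (d1t a b p)).
Proof.
rewrite -toC3_d1t.
exact: (complex_exact iu2 two_neq0 (@monomial_exact _ _ rc iu a b)).
Qed.
End RealPart.

(** * Bigrading and gluing *)

Ltac lia_bool :=
  repeat match goal with |- context [nat_of_bool ?b] => move: (nat_of_bool b) => ? end;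
  lia.

Section Bidegree.
Variable R : realType.
Implicit Types (A B L : mvf R) (I J K : {set 'I_3}) (m : 'X_{1..3}) (kr : nat * nat).

(* The bidegree of x^m d_I. *)
Definition wt I m : nat * nat :=
  let k := ((ix1 \notin I) + (ix2 \notin I) + m ix1 + m ix2)%N in
  (k, (k + ((ix3 \notin I) + m ix3))%N).

Definition in_wt kr A := forall I m, A I m != 0 -> wt I m = kr.

Lemma sum_app (S : Type) (V : zmodType) (Idx : finType) (P : pred Idx)
    (F : Idx -> S -> V) x :
  (\sum_(i | P i) F i) x = \sum_(i | P i) F i x.
Proof. by elim/big_rec2: _ => // i y z _ <-. Qed.

Lemma fps_scaleE (x : R) (f : fps R) m : (x *: f) m = x * f m. Proof. by []. Qed.

Lemma notinD I K j : I \subset K ->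
  ((j \notin I) + (j \notin K :\: I)%SET = (j \notin K) + 1)%N.
Proof.
move/fintype.subsetP/(_ j); rewrite inE negb_and negbK.
by case: (j \in I) => [->//|_]; case: (j \in K).
Qed.

Lemma notinU1 (i j : 'I_3) I : i \notin I ->
  ((j \notin (i |: I)%SET) + (i == j) = (j \notin I))%N.
Proof. by rewrite !inE negb_or [j == i]eq_sym; case: eqP => [->->|];
    rewrite ?addn0. Qed.

Lemma wtP I m kr : wt I m = kr <->
  ((ix1 \notin I) + (ix2 \notin I) + m ix1 + m ix2 = kr.1 /\
   kr.1 + ((ix3 \notin I) + m ix3) = kr.2)%N.
Proof.
by case: kr => k r; rewrite /wt /=; split=> [[-> <-]//|[-> <-]].
Qed.

(** Under a wedge product weights add up minus (2, 3), the weight of the constant 1; removing d_i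
    and differentiating in x_i compensate each other. As [L] has weight (2, 3), a coefficient of the
    bracket sees only coefficients of its own weight. *)
Lemma schouten_local L A B K m : in_wt (2, 3)%N L ->
  (forall I m', wt I m' = wt K m -> A I m' = B I m') ->
  schouten L A K m = schouten L B K m.
Proof.
move=> hL hAB; rewrite /schouten !big_ord3.
suff h i : wedge (odd_derivR i L) (mvf_deriv i A) K m
            - wedge (mvf_deriv i L) (odd_derivL i A) K m
         = wedge (odd_derivR i L) (mvf_deriv i B) K m
            - wedge (mvf_deriv i L) (odd_derivL i B) K m.
  by congr (_ + _ + _); exact: h.
rewrite /wedge !sum_app; congr (_ - _).
  apply: eq_bigr => I IK; congr (_ * _); apply: eq_bigr => -[k1 k2] /= /eqP/mnmP mE.
  rewrite /odd_derivR; case: ifPn => [_|iI]; first by rewrite !mul0r.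
  have [L0|/hL/wtP[/= w1 w2]] := eqVneq (L (i |: I)%SET k1) 0.
    by rewrite !fps_scaleE L0 mulr0 !mul0r.
  congr (_ * _); rewrite /mvf_deriv /fps_deriv hAB //; apply/wtP => /=.
  have [n1 n2 n3] := And3 (notinD ix1 IK) (notinD ix2 IK) (notinD ix3 IK).
  have [u1 u2 u3] := And3 (notinU1 ix1 iI) (notinU1 ix2 iI) (notinU1 ix3 iI).
  rewrite !mE !mnmDE !mnm1E; move: w1 w2 n1 n2 n3 u1 u2 u3; clear; lia_bool.
apply: eq_bigr => I IK; congr (_ * _); apply: eq_bigr => -[k1 k2] /= /eqP/mnmP mE.
rewrite /odd_derivL; case: ifPn => [_|iI]; first by rewrite !mulr0.
have [L0|/hL/wtP[/= w1 w2]] := eqVneq (L I (k1 + U_(i))%MM) 0.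
  by rewrite /mvf_deriv /fps_deriv L0 mul0rn !mul0r.
congr (_ * _); rewrite !fps_scaleE hAB //; apply/wtP => /=.
have [n1 n2 n3] := And3 (notinD ix1 IK) (notinD ix2 IK) (notinD ix3 IK).
have [u1 u2 u3] := And3 (notinU1 ix1 iI) (notinU1 ix2 iI) (notinU1 ix3 iI).
move: w1 w2 n1 n2 n3 u1 u2 u3; rewrite !mE !mnmDE !mnm1E; clear; lia_bool.
Qed.

Lemma schouten0 L : schouten L 0 = 0.
Proof.
rewrite /schouten !big_ord3; apply/funext => K; apply/funext => m.
have wedge0 A : wedge A 0 = 0.
  apply/funext => K'; rewrite /wedge big1 // => I _.
  by apply/funext => m'; rewrite fps_scaleE /fps_mul big1 ?mulr0 // => k _;
      rewrite mulr0.
have d0 i : mvf_deriv i (0 : mvf R) = 0.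
  by apply/funext => K'; apply/funext => m'; rewrite /mvf_deriv /fps_deriv mul0rn.
have o0 i : odd_derivL i (0 : mvf R) = 0.
  by apply/funext => K'; rewrite /odd_derivL scaler0; case: ifP.
by rewrite !d0 !o0 !wedge0 !subr0 !addr0.
Qed.

Definition proj kr A : mvf R := fun I m => if wt I m == kr then A I m else 0.

Lemma proj_schouten L A kr : in_wt (2, 3)%N L ->
  schouten L (proj kr A) = proj kr (schouten L A).
Proof.
move=> hL; apply/funext => K; apply/funext => m; rewrite /proj; case: eqP => h.
  by apply: schouten_local => // I m' ->; rewrite h eqxx.
rewrite (schouten_local hL (B := 0)) ?schouten0 // => I m' ->.
by case: eqP.
Qed.

Lemma proj_id kr A : in_wt kr A -> proj kr A = A.
Proof.
move=> h; apply/funext => I; apply/funext => m; rewrite /proj; case: eqP => // hw.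
by apply/esym/eqP; apply: contraT => /h.
Qed.

Lemma in_wt_proj kr A : in_wt kr (proj kr A).
Proof. by move=> I m; rewrite /proj; case: (wt I m =P kr) => // _ /eqP. Qed.

Lemma Rformal_proj d kr A : Rformal R d A -> Rformal R d (proj kr A).
Proof.
move=> h I hI; apply/funext => m; rewrite /proj (h I hI).
by case: ifP.
Qed.

Lemma proj_ext A B : (forall kr, proj kr A = proj kr B) -> A = B.
Proof.
move=> h; apply/funext => I; apply/funext => m.
by have := congr1 (fun A => A I m) (h (wt I m)); rewrite /proj eqxx.
Qed.

Lemma mvf_subE A B I m : (A - B) I m = A I m - B I m.
Proof. by []. Qed.

Lemma projB kr A B : proj kr (A - B) = proj kr A - proj kr B.
Proof.
apply/funext => I; apply/funext => m.
by rewrite mvf_subE /proj; case: ifP => _; rewrite ?mvf_subE ?subr0.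
Qed.

(** Each pair (I, m) has exactly one weight, so infinitely many homogeneous parts are assembled
    without any summation. *)
Definition glue (X : nat * nat -> mvf R) : mvf R := fun I m => X (wt I m) I m.

Lemma proj_glue kr X : proj kr (glue X) = proj kr (X kr).
Proof.
by apply/funext => I; apply/funext => m; rewrite /proj /glue;
    case: (wt I m =P kr) => [->|].
Qed.

Lemma Rformal_glue d X : (forall kr, Rformal R d (X kr)) -> Rformal R d (glue X).
Proof. by move=> h I hI; apply/funext => m; rewrite /glue h. Qed.

Section Gluing.
Variables (L : mvf R) (J : choiceType) (idx : J -> nat * nat) (W : J -> set (mvf R)).
Hypothesis L_wt : in_wt (2, 3)%N L.
Hypothesis idx_inj : injective idx.
Hypothesis RbiP : forall kr d A, (d == 1) || (d == 2)%N ->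
  Rbi R kr d A <-> Rformal R d A /\ in_wt kr A.
Hypothesis W_coh : forall j, cohomology_is L (Rbi R (idx j)) 2 (W j).
Hypothesis exact_off : forall kr, (forall j, idx j <> kr) ->
  forall A, cocycles L (Rbi R kr) 2 A -> coboundaries L (Rbi R kr) 2 A.

(** Reindexes a family by bidegrees, with 0 outside the image of [idx]; injectivity of [idx] makes
    the chosen preimage the right one. *)
Definition extend (F : J -> mvf R) kr : mvf R :=
  if pselect (exists j, idx j = kr) is left h then F (sval (cid h)) else 0.

Lemma extend_idx F j : extend F (idx j) = F j.
Proof.
rewrite /extend; case: pselect => [h|[]]; last by exists j.
by congr F; apply: idx_inj; apply: (svalP (cid h)).
Qed.

Lemma extend_off F kr : (forall j, idx j <> kr) -> extend F kr = 0.
Proof. by move=> h; rewrite /extend; case: pselect => // e; exfalso;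
    case: e => j /h. Qed.

Lemma extendP F (Q : nat * nat -> mvf R -> Prop) :
  (forall j, Q (idx j) (F j)) -> (forall kr, Q kr 0) -> forall kr, Q kr (extend F kr).
Proof.
move=> QF Q0 kr; rewrite /extend; case: pselect => // h.
by rewrite -[X in Q X _](svalP (cid h)); apply: QF.
Qed.

Lemma in_wt0 kr : in_wt kr 0. Proof. by move=> I m /eqP. Qed.

Lemma proj_extend F kr : (forall j, in_wt (idx j) (F j)) ->
  proj kr (glue (extend F)) = extend F kr.
Proof.
move=> hF; rewrite proj_glue proj_id //.
by apply: (extendP (Q := in_wt)) => // ?; exact: in_wt0.
Qed.

(** At (I, m) at most one index contributes, namely the one with [idx j] equal to [wt I m]. *)
Lemma formal_sum_glue F : (forall j, in_wt (idx j) (F j)) ->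
  is_formal_sum F (glue (extend F)).
Proof.
move=> hF I m; rewrite /glue.
have [[j jE]|nj] := pselect (exists j, idx j = wt I m).
  have F0 j' : j' != j -> F j' I m = 0.
    move=> jj; apply/eqP; apply: contraNT jj => /hF h.
    by apply/eqP; apply: idx_inj; rewrite jE.
  split.
    apply: (sub_finite_set (B := [set j])) => //= j' /= h.
    by apply/eqP; apply: contraNT h => /F0 ->.
  rewrite -jE extend_idx -(fsbig_widen [set j]) ?fsbig_set1 //.
  by move=> j' [_ /= /eqP /F0].
have F0 j : F j I m = 0.
  by apply/eqP; apply: contra_notT nj => /hF h; exists j; rewrite h.
split; first by rewrite (_ : [set _ | _] = set0) // -subset0 => j /=; rewrite F0 eqxx.
by rewrite extend_off => [|j h]; [rewrite fsbig1|apply: nj; exists j].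
Qed.

Lemma formal_sum_unique (F : J -> mvf R) A B :
  is_formal_sum F A -> is_formal_sum F B -> A = B.
Proof.
move=> hA hB; apply/funext => I; apply/funext => m.
by have [_ ->] := hA I m; have [_ ->] := hB I m.
Qed.

(** Primitives are chosen bidegree by bidegree and glued. Since [Lambda, -] commutes with the
    projections, the result is checked on each part. *)
Lemma glue_coboundary A : Rformal R 2 A ->
  (forall kr, coboundaries L (Rbi R kr) 2 (proj kr A)) ->
  coboundaries L (Rformal R) 2 A.
Proof.
move=> hA h.
have {}h kr : exists X, Rbi R kr 1 X /\ schouten L X = proj kr A.
  by have [X ? ?] := h kr; exists X.
have [X XP] := boolp.choice h.
exists (glue X); first by apply: Rformal_glue => kr; case: (XP kr) => /RbiP[].
apply: proj_ext => kr; rewrite -proj_schouten // proj_glue proj_id.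
  by case: (XP kr).
by case: (XP kr) => /RbiP[].
Qed.

Lemma proj_coboundary A kr : coboundaries L (Rformal R) 2 A ->
  coboundaries L (Rbi R kr) 2 (proj kr A).
Proof.
move=> [X hX <-]; exists (proj kr X); last exact: proj_schouten.
by apply/RbiP => //; split; [exact: Rformal_proj|exact: in_wt_proj].
Qed.

Lemma glue_cocycle (F : J -> mvf R) : (forall j, cocycles L (Rbi R (idx j)) 2 (F j)) ->
  cocycles L (Rformal R) 2 (glue (extend F)).
Proof.
move=> hF; split.
  apply: Rformal_glue; apply: (extendP (Q := fun _ => Rformal R 2)) => //.
  by move=> j; case: (hF j) => /RbiP[].
apply: proj_ext => kr; rewrite -proj_schouten // proj_extend.
  rewrite (_ : proj kr 0 = 0); last exact/proj_id/in_wt0.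
  apply: (extendP (Q := fun _ A => schouten L A = 0)) => [j|_]; last exact: schouten0.
  by case: (hF j).
by move=> j; case: (hF j) => /RbiP[].
Qed.

Lemma proj_cocycle kr A : cocycles L (Rformal R) 2 A ->
    cocycles L (Rbi R kr) 2 (proj kr A).
Proof.
move=> [hA dA]; split.
  by apply/RbiP => //; split; [exact: Rformal_proj|exact: in_wt_proj].
by rewrite proj_schouten // dA; apply/proj_id/in_wt0.
Qed.

Lemma coboundary0 kr : coboundaries L (Rbi R kr) 2 0.
Proof.
exists 0; last exact: schouten0.
by apply/RbiP => //; split=> //; exact: in_wt0.
Qed.

Lemma Rformal_B d A B : Rformal R d A -> Rformal R d B -> Rformal R d (A - B).
Proof.
move=> hA hB I hI; apply/funext => m.
by rewrite mvf_subE hA // hB // subr0.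
Qed.

(** In a bidegree outside the image of [idx] the part of [A] is a cocycle of an exact piece, so it
    may be dropped. *)
Lemma glue_cohomologous A F : cocycles L (Rformal R) 2 A ->
  (forall j, cocycles L (Rbi R (idx j)) 2 (F j)) ->
  (forall j, coboundaries L (Rbi R (idx j)) 2 (proj (idx j) A - F j)) ->
  coboundaries L (Rformal R) 2 (A - glue (extend F)).
Proof.
move=> hA hF h; apply: glue_coboundary.
  by apply: Rformal_B; [case: hA|case: (glue_cocycle hF)].
move=> kr; rewrite projB proj_extend; last by move=> j; case: (hF j) => /RbiP[].
have [[j <-]|nj] := pselect (exists j, idx j = kr); first by rewrite extend_idx.
have {}nj j : idx j <> kr by move=> e; apply: nj; exists j.
by rewrite extend_off // subr0; apply: exact_off => //; exact: proj_cocycle.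
Qed.

Lemma W_cocycle j B : W j B -> cocycles L (Rbi R (idx j)) 2 B.
Proof. by move=> WB; have [h _] := W_coh j; exact: h. Qed.

Lemma cocycle_wt F j : cocycles L (Rbi R (idx j)) 2 (F j : mvf R) ->
    in_wt (idx j) (F j).
Proof. by case=> /RbiP[]. Qed.

Theorem gluing_dsum : cohomology_dsum L 2 idx.
Proof.
split=> [F hF|A hA].
  have wF j := cocycle_wt (hF j).
  exists (glue (extend F)); split; [exact: formal_sum_glue|exact: glue_cocycle|].
  split=> [h j|h]; first by rewrite -(extend_idx F j) -proj_extend //;
      exact: proj_coboundary.
  apply: glue_coboundary; first by case: (glue_cocycle hF).
  move=> kr; rewrite proj_extend //.
  by apply: (extendP (Q := fun kr => coboundaries L (Rbi R kr) 2)) => // ?;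
      exact: coboundary0.
exists (fun j => proj (idx j) A), (glue (extend (fun j => proj (idx j) A))); split.
- by move=> j; exact: proj_cocycle.
- by apply: formal_sum_glue => j; exact: in_wt_proj.
- apply: glue_cohomologous => // j; first exact: proj_cocycle.
  by rewrite subrr; exact: coboundary0.
Qed.

Theorem gluing_direct : formally_direct W.
Proof.
split=> [F hF|F G A hF hG sF sG j].
  by exists (glue (extend F)); apply: formal_sum_glue => j; exact/cocycle_wt/W_cocycle.
have wF j' := cocycle_wt (W_cocycle (hF j')).
have wG j' := cocycle_wt (W_cocycle (hG j')).
rewrite -(extend_idx F) -(extend_idx G) -!proj_extend //; congr proj.
transitivity A; first exact: formal_sum_unique (formal_sum_glue wF) sF.
exact: formal_sum_unique sG (formal_sum_glue wG).
Qed.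

(** Existence glues the representatives of the parts. Uniqueness reduces to each bidegree because a
    coboundary projects to coboundaries. *)
Theorem gluing_cohomology : cohomology_is L (Rformal R) 2 (formal_sums W).
Proof.
split=> [A [F hF sF]|A hA].
  have cF j := W_cocycle (hF j).
  rewrite (formal_sum_unique sF (formal_sum_glue (fun j => cocycle_wt (cF j)))).
  exact: glue_cocycle.
have /boolp.choice[F FP] : forall j, exists B, (W j B /\
    coboundaries L (Rbi R (idx j)) 2 (proj (idx j) A - B)) /\
    forall B', W j B' /\ coboundaries L (Rbi R (idx j)) 2 (proj (idx j) A - B') ->
        B = B'.
  move=> j; have [_ /(_ _ (proj_cocycle (idx j) hA))[B [? ?]]] := W_coh j.
  by exists B.
have cF j : cocycles L (Rbi R (idx j)) 2 (F j) by apply: W_cocycle; case: (FP j) => -[].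
have wF j := cocycle_wt (cF j).
exists (glue (extend F)); split.
  split; first by exists F; [move=> j; case: (FP j) => -[]|exact: formal_sum_glue].
  by apply: glue_cohomologous => // j; case: (FP j) => -[].
move=> B [[G hG sG] cB].
have wG j := cocycle_wt (W_cocycle (hG j)).
have BE := formal_sum_unique sG (formal_sum_glue wG).
rewrite BE; congr (glue (extend _)); apply/funext => j.
case: (FP j) => _; apply; split=> //.
have := proj_coboundary (idx j) cB.
by rewrite BE projB proj_extend // extend_idx.
Qed.
End Gluing.
End Bidegree.

(** * Bidegree pieces as spaces of homogeneous polynomial fields *)

Section BigradedPieces.
Variable R : realType.
Implicit Types (p : {mpoly R[3]}) (A : mvf R) (m : 'X_{1..3}) (kr : nat * nat) (f : fps
    R).

(** The exponents being natural numbers, the equations have no solution unless 0 <= k <= r; this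
    absorbs the case distinction in [Pkr]. *)
Lemma PkrP (k r : int) f : Pkr R k r f <->
  forall m, f m != 0 -> (m ix1 + m ix2)%N%:Z = k /\ (m ix3)%:Z = r - k.
Proof.
pose mon l := (U_(ix1) *+ l + U_(ix2) *+ (`|k|%N - l) + U_(ix3) *+ `|r - k|%N)%MM.
have monE l : [/\ mon l ix1 = l, mon l ix2 = (`|k|%N - l)%N & mon l ix3 = `|r - k|%N].
  by split; rewrite /mon !mnmDE !mulmnE !mnm1E /= ?(muln0, mul0n, mul1n, muln1, addn0,
      add0n).
rewrite /Pkr; case: ifP => [/andP[k0 kr]|kr]; last first.
  split=> [-> m|h]; first by rewrite eqxx.
  apply/funext => m; apply/eqP; apply: contraT => /h[h1 h2].
  by move: kr; lia.
have sE : size [seq fps_monom R (mon l) | l <- iota 0 `|k|%N.+1] = `|k|%N.+1.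
  by rewrite size_map size_iota.
have nE (i : nat) : (i < `|k|.+1)%N ->
    [seq fps_monom R (mon l) | l <- iota 0 `|k|%N.+1]`_i = fps_monom R (mon i).
  by move=> hi; rewrite (nth_map 0%N) ?size_iota // nth_iota.
split=> [[c ->] m|h].
  rewrite -/mon sum_app => hm.
  have [n] : exists i : 'I_(size [seq fps_monom R (mon l) | l <- iota 0 `|k|%N.+1]),
      c i * [seq fps_monom R (mon l) | l <- iota 0 `|k|%N.+1]`_i m != 0.
    apply/existsP; apply: contraNT hm; rewrite negb_exists => /forallP h.
    by rewrite big1 // => i _; apply/eqP; have := h i; rewrite negbK.
  have hi := ltn_ord n; rewrite [X in (_ < X)%N]sE in hi.
  rewrite nE // mulf_eq0 negb_or /fps_monom pnatr_eq0 eqb0 negbK => /andP[_ /eqP ->].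
  by have [-> -> ->] := monE n; lia.
exists (fun l => f (mon l)); apply/funext => m; rewrite -/mon sum_app.
rewrite (eq_bigr (fun i : 'I__ => (f (mon i) : R) * (m == mon i)%:R)); last first.
  by move=> i _; have hi := ltn_ord i; rewrite [X in (_ < X)%N]sE in hi;
      rewrite fps_scaleE nE.
have [m0|/h[h1 h2]] := eqVneq (f m) 0.
  rewrite m0 big1 // => i _; case: eqP => [<-|_]; last by rewrite mulr0.
  by rewrite m0 mul0r.
have mm : m = mon (m ix1).
  apply/mnmP; have [e1 e2 e3] := monE (m ix1).
  by apply: ord3P; rewrite ?e1 ?e2 ?e3 //; lia.
have hi : (m ix1 < size [seq fps_monom R (mon l) | l <- iota 0 `|k|%N.+1])%N by rewrite
    sE; lia.
rewrite (bigD1 (Ordinal hi)) //= -mm eqxx mulr1 big1 ?addr0 // => i ii.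
case: eqP => [e|_]; last by rewrite mulr0.
case/eqP: ii; apply: val_inj => /=.
by have [<- _ _] := monE i; rewrite -e.
Qed.

Lemma Pkr_poly k r f : Pkr R k r f -> exists p, f = fps_of p.
Proof.
move/PkrP => h; have [|p pE] := @mpoly_of_fun R (`|k| + `|r - k|).+1 f.
  move=> m hm; apply/eqP; apply: contraT => /h[h1 h2].
  move: hm; rewrite mdegE !big_ord_recl big_ord0 /=.
  rewrite (_ : lift ord0 (lift ord0 ord0) = ix3); last exact: val_inj.
  rewrite (_ : lift ord0 ord0 = ix2); last exact: val_inj.
  rewrite (_ : ord0 = ix1); last exact: val_inj.
  by lia.
by exists p; apply/funext => m; rewrite /fps_of pE.
Qed.

Lemma wt_bset e m : wt (bset e) m =
  let k := (~~ e.1.1 + ~~ e.1.2 + m ix1 + m ix2)%N in (k, (k + (~~ e.2 + m ix3))%N).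
Proof. by rewrite /wt !inE. Qed.

Lemma card_bset e : #|bset e| = (e.1.1 + e.1.2 + e.2)%N.
Proof.
rewrite -sum1_card big_mkcond !big_ord_recl big_ord0 !inE /=.
by case: e => [[[] []] []].
Qed.

Lemma Rformal_mv1 p1 p2 p3 : Rformal R 1 (mv1 p1 p2 p3).
Proof.
move=> I; rewrite -[I]setbK card_bset /mv1 /mvp bsetK.
by case: (setb I) => [[[] []] []] //= _; rewrite fps_of0.
Qed.

Lemma Rformal_mv2 p1 p2 p3 : Rformal R 2 (mv2 p1 p2 p3).
Proof.
move=> I; rewrite -[I]setbK card_bset /mv2 /mvp bsetK.
by case: (setb I) => [[[] []] []] //= _; rewrite fps_of0.
Qed.

Lemma Rformal_mv1E A p1 p2 p3 : Rformal R 1 A ->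
  A (bset (true, false, false)) = fps_of p1 ->
  A (bset (false, true, false)) = fps_of p2 ->
  A (bset (false, false, true)) = fps_of p3 -> A = mv1 p1 p2 p3.
Proof.
move=> hA h1 h2 h3; apply/funext => I; rewrite -[I]setbK /mv1 /mvp bsetK.
case: (setb I) => [[[] []] []] //; rewrite fps_of0 hA //; by rewrite card_bset.
Qed.

Lemma Rformal_mv2E A p1 p2 p3 : Rformal R 2 A ->
  A (bset (false, true, true)) = fps_of p1 ->
  A (bset (true, false, true)) = - fps_of p2 ->
  A (bset (true, true, false)) = fps_of p3 -> A = mv2 p1 p2 p3.
Proof.
move=> hA h1 h2 h3; apply/funext => I; rewrite -[I]setbK /mv2 /mvp bsetK.
case: (setb I) => [[[] []] []] //; rewrite -?fps_ofN // fps_of0 hA //;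
    by rewrite card_bset.
Qed.

Lemma mv1_scale p1 p2 p3 : fps_scale (fps_of p1) (partial R ix1)
  + fps_scale (fps_of p2) (partial R ix2) + fps_scale (fps_of p3) (partial R ix3)
  = mv1 p1 p2 p3.
Proof.
rewrite !partial_mvp !fps_scale_mvp !mvpD; apply: eq_mvp.
by move=> [[[] []] []]; rewrite !bunitE /= ?(mulr0, mulr1, addr0, add0r).
Qed.

Lemma mv2_scale p1 p2 p3 : fps_scale (fps_of p1) (d23 R)
  + fps_scale (fps_of p2) (d31 R) + fps_scale (fps_of p3) (d12 R) = mv2 p1 p2 p3.
Proof.
rewrite d23E d31E d12E /mv2 !fps_scale_mvp !mvpD; apply: eq_mvp.
by move=> [[[] []] []] /=; ring.
Qed.

Lemma in_wt_mv1 kr p1 p2 p3 : in_wt kr (mv1 p1 p2 p3) <-> forall m,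
  [/\ p1@_m != 0 -> wt (bset (true, false, false)) m = kr,
      p2@_m != 0 -> wt (bset (false, true, false)) m = kr
    & p3@_m != 0 -> wt (bset (false, false, true)) m = kr].
Proof.
split=> [h m|h I m].
  by split=> hm; apply: h; rewrite /mv1 /mvp bsetK.
rewrite -[I]setbK /mv1 /mvp bsetK; have [h1 h2 h3] := h m.
by case: (setb I) => [[[] []] []] //; rewrite /fps_of mcoeff0 eqxx.
Qed.

Lemma in_wt_mv2 kr p1 p2 p3 : in_wt kr (mv2 p1 p2 p3) <-> forall m,
  [/\ p1@_m != 0 -> wt (bset (false, true, true)) m = kr,
      p2@_m != 0 -> wt (bset (true, false, true)) m = kr
    & p3@_m != 0 -> wt (bset (true, true, false)) m = kr].
Proof.
split=> [h m|h I m].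
  split=> hm; apply: h; rewrite /mv2 /mvp bsetK //.
  by rewrite /fps_of mcoeffN oppr_eq0.
rewrite -[I]setbK /mv2 /mvp bsetK; have [h1 h2 h3] := h m.
by case: (setb I) => [[[] []] []] //;
    rewrite /fps_of ?mcoeff0 ?eqxx // mcoeffN oppr_eq0.
Qed.

(** The index shifts in the definition of the pieces amount to counting one for each d_i that is
    missing, as [wt] does. *)
Lemma RbiP kr d A : (d == 1)%N || (d == 2)%N ->
  Rbi R kr d A <-> Rformal R d A /\ in_wt kr A.
Proof.
case: kr => k r; case/orP=> /eqP -> /=; split.
- move=> [f [g [h [Pf Pg Ph ->]]]].
  move: (Pf) (Pg) (Ph) => /Pkr_poly[p1 e1] /Pkr_poly[p2 e2] /Pkr_poly[p3 e3].
  rewrite e1 e2 e3 mv1_scale; split; first exact: Rformal_mv1.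
  move/PkrP: Pf => Pf; move/PkrP: Pg => Pg; move/PkrP: Ph => Ph.
  apply/in_wt_mv1 => m; have [] := And3 (Pf m) (Pg m) (Ph m).
  rewrite e1 e2 e3 /fps_of !wt_bset /= => h1 h2 h3.
  by split=> /[dup] ? ; [case/h1|case/h2|case/h3] => ? ?; congr (_, _); lia.
- move=> [fA wA].
  have P e : forall m, A (bset e) m != 0 -> wt (bset e) m = (k, r) by move=> m /wA.
  have P1 : Pkr R (k%:Z - 1) (r%:Z - 2) (A (bset (true, false, false))).
    by apply/PkrP => m /P; rewrite wt_bset /= => -[? ?]; lia.
  have P2 : Pkr R (k%:Z - 1) (r%:Z - 2) (A (bset (false, true, false))).
    by apply/PkrP => m /P; rewrite wt_bset /= => -[? ?]; lia.
  have P3 : Pkr R (k%:Z - 2) (r%:Z - 2) (A (bset (false, false, true))).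
    by apply/PkrP => m /P; rewrite wt_bset /= => -[? ?]; lia.
  do 3![eexists]; split; [exact: P1|exact: P2|exact: P3|].
  move: (P1) (P2) (P3) => /Pkr_poly[p1 e1] /Pkr_poly[p2 e2] /Pkr_poly[p3 e3].
  by rewrite e1 e2 e3 mv1_scale; exact: Rformal_mv1E.
- move=> [f [g [h [Pf Pg Ph ->]]]].
  move: (Pf) (Pg) (Ph) => /Pkr_poly[p1 e1] /Pkr_poly[p2 e2] /Pkr_poly[p3 e3].
  rewrite e1 e2 e3 mv2_scale; split; first exact: Rformal_mv2.
  move/PkrP: Pf => Pf; move/PkrP: Pg => Pg; move/PkrP: Ph => Ph.
  apply/in_wt_mv2 => m; have [] := And3 (Pf m) (Pg m) (Ph m).
  rewrite e1 e2 e3 /fps_of !wt_bset /= => h1 h2 h3.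
  by split=> /[dup] ? ; [case/h1|case/h2|case/h3] => ? ?; congr (_, _); lia.
- move=> [fA wA].
  have P e : forall m, A (bset e) m != 0 -> wt (bset e) m = (k, r) by move=> m /wA.
  have P1 : Pkr R (k%:Z - 1) (r%:Z - 1) (A (bset (false, true, true))).
    by apply/PkrP => m /P; rewrite wt_bset /= => -[? ?]; lia.
  have P2 : Pkr R (k%:Z - 1) (r%:Z - 1) (- A (bset (true, false, true))).
    apply/PkrP => m hm; have : A (bset (true, false, true)) m != 0 by rewrite -oppr_eq0.
    by move/P; rewrite wt_bset /= => -[? ?]; lia.
  have P3 : Pkr R k%:Z (r%:Z - 1) (A (bset (true, true, false))).
    by apply/PkrP => m /P; rewrite wt_bset /= => -[? ?]; lia.
  do 3![eexists]; split; [exact: P1|exact: P2|exact: P3|].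
  move: (P1) (P2) (P3) => /Pkr_poly[p1 e1] /Pkr_poly[p2 e2] /Pkr_poly[p3 e3].
  by rewrite e1 e2 e3 mv2_scale; apply: Rformal_mv2E => //; rewrite -e2 opprK.
Qed.
End BigradedPieces.

Section Homogeneous.
Variable A : comNzRingType.
Implicit Types p q : {mpoly A[3]}.

Definition bihom n s p := forall m, p@_m != 0 -> (m ix1 + m ix2)%N = n /\ m ix3 = s.

Lemma bihom0 n s : bihom n s 0. Proof. by move=> m; rewrite mcoeff0 eqxx. Qed.

Lemma bihomD n s p q : bihom n s p -> bihom n s q -> bihom n s (p + q).
Proof.
move=> hp hq m; rewrite mcoeffD.
by have [->|/hp//] := eqVneq (p@_m) 0; rewrite add0r => /hq.
Qed.

Lemma bihomN n s p : bihom n s p -> bihom n s (- p).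
Proof. by move=> hp m; rewrite mcoeffN oppr_eq0 => /hp. Qed.

Lemma bihomM n s n' s' p q : bihom n s p -> bihom n' s' q ->
    bihom (n + n') (s + s') (p * q).
Proof.
move=> hp hq m; rewrite mcoeffM => h.
have [k /andP[/eqP/mnmP mE hk]] : exists k : 'X_{1..3 < (mdeg m).+1, (mdeg m).+1},
    (m == (k.1 + k.2)%MM) && (p@_k.1 * q@_k.2 != 0).
  apply/existsP; apply: contraNT h; rewrite negb_exists => /forallP h.
  by rewrite big1 // => k mk; apply/eqP; have := h k; rewrite mk /= negbK.
have /hp[h1 h2] : p@_k.1 != 0 by apply: contraNneq hk => ->; rewrite mul0r.
have /hq[h3 h4] : q@_k.2 != 0 by apply: contraNneq hk => ->; rewrite mulr0.
by rewrite !mE !mnmDE; lia.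
Qed.

Lemma bihomC c : bihom 0 0 c%:MP.
Proof. by move=> m; rewrite mcoeffC; case: (m =P 0%MM) => [->|_];
    rewrite ?mnm0E // mulr0 eqxx. Qed.

Lemma bihomCM n s c p : bihom n s p -> bihom n s (c%:MP * p).
Proof. by move=> hp; have := bihomM (@bihomC c) hp; rewrite !add0n. Qed.

Lemma bihom1 : bihom 0 0 1. Proof. exact: bihomC. Qed.

Lemma bihom2 : bihom 0 0 2. Proof. exact: bihomD bihom1 bihom1. Qed.

Lemma bihomX n s p k : bihom n s p -> bihom (n * k) (s * k) (p ^+ k).
Proof.
move=> hp; elim: k => [|k IH]; first by rewrite !muln0 expr0; exact: bihom1.
by rewrite !mulnS exprS; exact: bihomM.
Qed.

Lemma bihom_x1 : bihom 1 0 x1.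
Proof. by move=> m; rewrite mcoeffX; case: (_ =P m) => [<-|];
    rewrite ?eqxx // !mnm1E. Qed.
Lemma bihom_x2 : bihom 1 0 x2.
Proof. by move=> m; rewrite mcoeffX; case: (_ =P m) => [<-|];
    rewrite ?eqxx // !mnm1E. Qed.
Lemma bihom_x3 : bihom 0 1 x3.
Proof. by move=> m; rewrite mcoeffX; case: (_ =P m) => [<-|];
    rewrite ?eqxx // !mnm1E. Qed.

Lemma bihom_comp n s p (l : 3.-tuple {mpoly A[3]}) : bihom 1 0 l`_0 -> bihom 1 0 l`_1 ->
  bihom 0 1 l`_2 -> bihom n s p -> bihom n s (p \mPo l).
Proof.
move=> h1 h2 h3 hp; rewrite comp_mpolyEX big_seq.
apply: (big_ind (bihom n s)) => [||m]; [exact: bihom0|exact: bihomD|].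
rewrite mcoeff_msupp => /hp[<- <-]; rewrite -mul_mpolyC; apply: bihomCM.
rewrite comp_mpolyX !big_ord_recl big_ord0 mulr1 !(tnth_nth 0) /=.
rewrite (_ : lift ord0 (lift ord0 ord0) = ix3); last exact: val_inj.
rewrite (_ : lift ord0 ord0 = ix2); last exact: val_inj.
rewrite (_ : ord0 = ix1); last exact: val_inj.
have := bihomM (@bihomX _ _ _ (m ix1) h1) (bihomM (@bihomX _ _ _ (m ix2) h2) (@bihomX _
    _ _ (m ix3) h3)).
by rewrite !mul0n !mul1n addn0 !add0n.
Qed.

(** Coefficients of d23, d31, d12 in bidegree (k, k + s). The successors are the factors x1, x2 or
    x3 gained on passing to A /\ Y_i: all three scalars have degree k in x1, x2 and degree s in
    x3. *)
Definition bihom3 k s (t : {mpoly A[3]} * {mpoly A[3]} * {mpoly A[3]}) := forall m,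
  [/\ t.1.1@_m != 0 -> (m ix1 + m ix2).+1 = k /\ m ix3 = s,
      t.1.2@_m != 0 -> (m ix1 + m ix2).+1 = k /\ m ix3 = s
    & t.2@_m != 0 -> (m ix1 + m ix2)%N = k /\ (m ix3).+1 = s].

Lemma bihom3_0 k s : bihom3 k s 0.
Proof. by move=> m; rewrite !mcoeff0 eqxx. Qed.

Lemma bihom3_lin k s c t u : bihom3 k s t -> bihom3 k s u -> bihom3 k s (c *: t + u).
Proof.
move=> ht hu m; have [h1 h2 h3] := ht m; have [u1 u2 u3] := hu m.
split; rewrite mcoeffD mcoeffZ.
- by have [->|/h1//] := eqVneq (t.1.1@_m) 0; rewrite mulr0 add0r => /u1.
- by have [->|/h2//] := eqVneq (t.1.2@_m) 0; rewrite mulr0 add0r => /u2.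
- by have [->|/h3//] := eqVneq (t.2@_m) 0; rewrite mulr0 add0r => /u3.
Qed.

Lemma bihom3_sum k s n (c : 'I_n -> A) (e : 'I_n -> _) :
  (forall i, bihom3 k s (e i)) -> bihom3 k s (\sum_(i < n) c i *: e i).
Proof.
move=> he; elim/big_ind: _ => [|t u ht hu|i _]; first exact: bihom3_0.
  by rewrite -[t]scale1r; exact: bihom3_lin.
by rewrite -[X in bihom3 _ _ X]addr0; apply: bihom3_lin => //; exact: bihom3_0.
Qed.

Lemma bihom3P k s p1 p2 p3 : (forall n, n.+1 = k -> bihom n s p1 /\ bihom n s p2) ->
  (k = 0%N -> p1 = 0 /\ p2 = 0) ->
  (forall n, n.+1 = s -> bihom k n p3) -> (s = 0%N -> p3 = 0) -> bihom3 k s (p1, p2,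
      p3).
Proof.
move=> h12 h12' h3 h3' m; split=> /=.
- case: k h12 h12' {h3 h3'} => [_ /(_ erefl)[-> _]|n /(_ _ erefl)[h _] _].
    by rewrite mcoeff0 eqxx.
  by move/h => [-> ->].
- case: k h12 h12' {h3 h3'} => [_ /(_ erefl)[_ ->]|n /(_ _ erefl)[_ h] _].
    by rewrite mcoeff0 eqxx.
  by move/h => [-> ->].
- case: s h3 h3' {h12 h12'} => [_ /(_ erefl)->|n /(_ _ erefl) h _].
    by rewrite mcoeff0 eqxx.
  by move/h => [-> ->].
Qed.
End Homogeneous.

Section Real.
Variable R : realType.
Local Notation T := ({mpoly R[3]} * {mpoly R[3]} * {mpoly R[3]})%type.
Variables a b : R.

Definition mv2t (q : T) : mvf R := mv2 q.1.1 q.1.2 q.2.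
Definition mv1t (q : T) : mvf R := mv1 q.1.1 q.1.2 q.2.
Definition mulT (p : {mpoly R[3]}) (q : T) : T := (p * q.1.1, p * q.1.2, p * q.2).

Lemma in_wt_mv2t k s q : in_wt (k, k + s)%N (mv2t q) <-> bihom3 k s q.
Proof.
split=> [/in_wt_mv2 h m|h].
  by have [h1 h2 h3] := h m; split; [move/h1|move/h2|move/h3];
     rewrite wt_bset /= => -[? ?]; lia.
apply/in_wt_mv2 => m; have [h1 h2 h3] := h m.
by split; [move/h1|move/h2|move/h3]; rewrite wt_bset /= => -[? ?]; congr (_, _); lia.
Qed.

Lemma Lam_wt : in_wt (2, 3)%N (Lam a b).
Proof.
rewrite LamE -[X in in_wt X _]/(2, 2 + 1)%N -/(mv2t (_, _, _)).
have hx1 := @bihom_x1 R; have hx2 := @bihom_x2 R.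
have c2 (p : {mpoly R[3]}) : bihom 1 0 p -> bihom 1 0 (2 * b%:MP * p).
  by move=> hp; rewrite -mulrA; exact: (@bihomM _ 0 0 1 0) (@bihom2 R) (@bihomCM _ _ _
      _ _ hp).
apply/in_wt_mv2t/bihom3P => //= n [->].
  split; apply: (@bihomM _ 1 0 0 1) (@bihom_x3 R); apply: bihomD.
  - exact: c2.
  - by apply: bihomN; exact: bihomCM.
  - exact: c2.
  - exact: bihomCM.
by apply: bihomCM; apply: bihomD;
    [exact: (@bihomX _ 1 0 _ 2 hx1)|exact: (@bihomX _ 1 0 _ 2 hx2)].
Qed.

Lemma fps_of_inj : injective (@fps_of R).
Proof. by move=> p q h; apply/mpolyP => m; have := congr1 (fun f => f m) h. Qed.

Lemma mvp_inj c c' : mvp (R := R) c = mvp c' -> c =1 c'.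
Proof.
by move=> h e; apply: fps_of_inj; have := congr1 (fun A => A (bset e)) h;
    rewrite /mvp bsetK.
Qed.

Lemma mv2t_inj : injective mv2t.
Proof.
move=> [[q1 q2] q3] [[r1 r2] r3] /mvp_inj h.
have /= -> := h (false, true, true); have /= /oppr_inj -> := h (true, false, true).
by have /= -> := h (true, true, false).
Qed.

Lemma mv2t_is_linear : linear mv2t.
Proof.
move=> c q r; rewrite /mv2t /mv2 mvpZ mvpD; apply: eq_mvp => -[[[] []] []] /=;
  rewrite -?mul_mpolyC; ring.
Qed.
HB.instance Definition _ := GRing.isLinear.Build R T (mvf R) _ mv2t mv2t_is_linear.

Lemma mulT_is_linear p : linear (mulT p).
Proof.
move=> c q r; rewrite /mulT; congr (_, _, _) => /=; rewrite -!mul_mpolyC; ring.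
Qed.
HB.instance Definition _ p := GRing.isLinear.Build R T T _ (mulT p) (mulT_is_linear p).

Lemma fps_scale_mv2t p q : fps_scale (fps_of p) (mv2t q) = mv2t (mulT p q).
Proof.
rewrite /mv2t /mv2 fps_scale_mvp; apply: eq_mvp => -[[[] []] []] /=; ring.
Qed.

Lemma rspan_mv2t (es : seq T) A : rspan [seq mv2t t | t <- es] A <->
  exists c : nat -> R, A = mv2t (\sum_(i < size es) c i *: es`_i).
Proof.
have E (c : nat -> R) : \sum_(i < size [seq mv2t t | t <- es]) c i *: [seq mv2t t | t
    <- es]`_i
    = mv2t (\sum_(i < size es) c i *: es`_i).
  rewrite linear_sum size_map; apply: eq_bigr => i _.
  by rewrite linearZ /= (nth_map 0).
by split=> -[c ->]; exists c; rewrite E.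
Qed.

Lemma rspan_scale p (es : seq T) :
  [set fps_scale (fps_of p) A | A in rspan [seq mv2t t | t <- es]] =
  rspan [seq mv2t t | t <- [seq mulT p t | t <- es]].
Proof.
have E (c : nat -> R) : mulT p (\sum_(i < size es) c i *: es`_i) =
    \sum_(i < size [seq mulT p t | t <- es]) c i *: [seq mulT p t | t <- es]`_i.
  rewrite linear_sum size_map; apply: eq_bigr => i _.
  by rewrite linearZ /= (nth_map 0).
apply/seteqP; split=> A.
  by move=> [B /rspan_mv2t[c ->] <-]; apply/rspan_mv2t; exists c;
      rewrite fps_scale_mv2t E.
move=> /rspan_mv2t[c ->]; exists (mv2t (\sum_(i < size es) c i *: es`_i)).
  by apply/rspan_mv2t; exists c.
by rewrite fps_scale_mv2t E.
Qed.

Lemma schouten_mv2t q : schouten (Lam a b) (mv2t q) = - mv3 (d2t a b q).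
Proof. exact: schouten_mv2. Qed.

Lemma schouten_mv1t p : schouten (Lam a b) (mv1t p) = mv2t (d1t a b p).
Proof. exact: schouten_mv1. Qed.

Lemma mv3_eq0 p : (mv3 p : mvf R) = 0 -> p = 0.
Proof.
move=> h; apply: fps_of_inj; have := congr1 (fun A : mvf R => A (bset (true, true,
    true))) h.
by rewrite /mv3 /mvp bsetK fps_of0.
Qed.

Lemma mv30 : mv3 0 = 0 :> mvf R.
Proof.
by apply/funext => I; rewrite /mv3 /mvp; case: (setb I) => [[[] []] []];
    rewrite fps_of0.
Qed.

Lemma Rbi1_mv1t kr A : Rbi R kr 1 A -> exists p, A = mv1t p.
Proof.
move=> [f [g [h [/Pkr_poly[p1 ->] /Pkr_poly[p2 ->] /Pkr_poly[p3 ->] ->]]]].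
by exists (p1, p2, p3); rewrite mv1_scale.
Qed.

Lemma Rbi2_mv2t kr A : Rbi R kr 2 A -> exists q, A = mv2t q.
Proof.
move=> [f [g [h [/Pkr_poly[p1 ->] /Pkr_poly[p2 ->] /Pkr_poly[p3 ->] ->]]]].
by exists (p1, p2, p3); rewrite mv2_scale.
Qed.

Lemma cocycle_mv2t k s q : cocycles (Lam a b) (Rbi R (k, k + s)%N) 2 (mv2t q) <->
  bihom3 k s q /\ d2t a b q = 0.
Proof.
split=> [[/RbiP[//|_ /in_wt_mv2t hq]]|[hq dq]].
  by rewrite schouten_mv2t => /eqP; rewrite oppr_eq0 => /eqP/mv3_eq0.
split; last by rewrite schouten_mv2t dq mv30 oppr0.
by apply/RbiP => //; split; [exact: Rformal_mv2|apply/in_wt_mv2t].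
Qed.
End Real.

(** * Cohomology of one bidegree *)

Section Criterion.
Variables (R : realType) (K : fieldType) (rc : {rmorphism R -> K})
  (re im : {additive K -> R}) (iu : K).
Hypothesis iu2 : iu * iu = -1.
Hypothesis reim : forall z, z = rc (re z) + iu * rc (im z).
Hypothesis re_rc : forall z x, re (z * rc x) = re z * x.
Hypothesis re1 : re 1 = 1.
Hypothesis reiu : re iu = 0.
Local Notation P K := {mpoly K[3]}.
Local Notation T K := (P K * P K * P K)%type.
Variables a b : R.
Local Notation toC3 := (map3 rc).
Local Notation psi := (psi iu).
Local Notation phi := (phi iu).
Local Notation vanish3 := (vanish3 iu a).

(** With [kapw] and [kap3]: for exceptional [m], the linear functionals that detect cohomology
    classes. *)
Definition kapz m (t : T K) : K^o := (Gz iu t.1.1 t.1.2)@_m.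
Definition kapw m (t : T K) : K^o := (Gw iu t.1.1 t.1.2)@_m.
Definition kap3 m (t : T K) : K^o := (G3 iu t.2)@_m.

Lemma psi_lin c p q : psi (c%:MP * p + q) = c%:MP * psi p + psi q.
Proof. by rewrite psiD psiM psiC. Qed.

Lemma kapz_is_linear m : linear (kapz m).
Proof.
move=> c [[t1 t2] t3] [[u1 u2] u3]; rewrite /kapz /Gz /= -!mul_mpolyC.
have -> : c%:MP * t1 + u1 + iu%:MP * (c%:MP * t2 + u2) =
  c%:MP * (t1 + iu%:MP * t2) + (u1 + iu%:MP * u2) by ring.
by rewrite psi_lin mulrDr mcoeffD [x2 * (_ * _)]mulrCA mcoeffCM.
Qed.
HB.instance Definition _ m := GRing.isLinear.Build K (T K) K^o _ (kapz m)
    (kapz_is_linear m).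

Lemma kapw_is_linear m : linear (kapw m).
Proof.
move=> c [[t1 t2] t3] [[u1 u2] u3]; rewrite /kapw /Gw /= -!mul_mpolyC.
have -> : c%:MP * t1 + u1 - iu%:MP * (c%:MP * t2 + u2) =
  c%:MP * (t1 - iu%:MP * t2) + (u1 - iu%:MP * u2) by ring.
by rewrite psi_lin mulrDr mcoeffD [x1 * (_ * _)]mulrCA mcoeffCM.
Qed.
HB.instance Definition _ m := GRing.isLinear.Build K (T K) K^o _ (kapw m)
    (kapw_is_linear m).

Lemma kap3_is_linear m : linear (kap3 m).
Proof.
move=> c [[t1 t2] t3] [[u1 u2] u3]; rewrite /kap3 /G3 /= -!mul_mpolyC.
by rewrite psi_lin mulrDr mcoeffD [x3 * (_ * _)]mulrCA mcoeffCM.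
Qed.
HB.instance Definition _ m := GRing.isLinear.Build K (T K) K^o _ (kap3 m)
    (kap3_is_linear m).

Section KapSums.
Variables (m : 'X_{1..3}) (n : nat) (q : T K) (c : 'I_n -> K) (e : 'I_n -> T K).

Lemma kapz_sum : kapz m (\sum_(i < n) c i *: e i) = \sum_(i < n) c i * kapz m (e i).
Proof. by rewrite linear_sum; apply: eq_bigr => i _; rewrite linearZ. Qed.
Lemma kapw_sum : kapw m (\sum_(i < n) c i *: e i) = \sum_(i < n) c i * kapw m (e i).
Proof. by rewrite linear_sum; apply: eq_bigr => i _; rewrite linearZ. Qed.
Lemma kap3_sum : kap3 m (\sum_(i < n) c i *: e i) = \sum_(i < n) c i * kap3 m (e i).
Proof. by rewrite linear_sum; apply: eq_bigr => i _; rewrite linearZ. Qed.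

Lemma kapzB t u : kapz m (t - u) = kapz m t - kapz m u. Proof. exact: linearB. Qed.
Lemma kapwB t u : kapw m (t - u) = kapw m t - kapw m u. Proof. exact: linearB. Qed.
Lemma kap3B t u : kap3 m (t - u) = kap3 m t - kap3 m u. Proof. exact: linearB. Qed.
End KapSums.

Lemma vanish3P t : vanish3 t <->
  forall m, bad a m -> [/\ kapz m t = 0, kapw m t = 0 & kap3 m t = 0].
Proof. by []. Qed.

Lemma bihom_psi n s p : bihom n s p -> bihom n s (psi p).
Proof.
apply: bihom_comp => /=.
- by apply: bihomCM; apply: bihomD; [exact: bihom_x1|exact: bihom_x2].
- rewrite -mpolyCN; apply: bihomCM; apply: bihomD; first exact: bihom_x1.
  by apply: bihomN; exact: bihom_x2.
- exact: bihom_x3.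
Qed.

Lemma kap_hom k s (m : 'X_{1..3}) (t : T K) : bihom3 k s t ->
    ~ ((m ix1 + m ix2)%N = k /\ m ix3 = s) ->
  [/\ kapz m t = 0, kapw m t = 0 & kap3 m t = 0].
Proof.
move=> ht nm.
have h12 (x : K) : exists2 n, bihom n s (t.1.1 + x%:MP * t.1.2) &
    forall r, r = n -> (0 < m ix1 + m ix2)%N -> r = (m ix1 + m ix2).-1%N -> m ix3 <> s.
  (* For k = 0 the first two components are zero, hence homogeneous of every degree; the default is
     a degree that differs from (m ix1 + m ix2) - 1 when that sum is positive. *)
  exists (if k is k'.+1 then k' else (m ix1 + m ix2)%N); last by case: (k) nm; lia.
  apply: bihomD => [|]; [|apply: bihomCM] => m'; have [h1 h2 _] := ht m'.
    by move/h1 => [<- <-].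
  by move/h2 => [<- <-].
have h3 : exists2 n, bihom k n t.2 & forall r,
    r = n -> (0 < m ix3)%N -> r = (m ix3).-1 ->
    (m ix1 + m ix2)%N <> k.
  exists (if s is s'.+1 then s' else m ix3); last by case: (s) nm; lia.
  by move=> m'; have [_ _ h] := ht m'; move/h => [<- <-].
split; rewrite /kapz /kapw /kap3 mcoeff_XM; case: (m _ =P 0%N) => // mi;
  apply/eqP; apply: contraT.
- have [n /bihom_psi hn h] := h12 iu.
  by case/hn; rewrite !mnmBE !mnm1E /= => e1 e2; case: (h _ e1); lia.
- have [n] := h12 (- iu); rewrite mpolyCN mulNr => /bihom_psi hn h.
  by case/hn; rewrite !mnmBE !mnm1E /= => e1 e2; case: (h _ e1); lia.
- have [n /bihom_psi hn h] := h3.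
  by case/hn; rewrite !mnmBE !mnm1E /= => e1 e2; case: (h _ e2); lia.
Qed.

Lemma vanish3_hom k s (t : T K) : bihom3 k s t ->
  (forall m, bad a m -> (m ix1 + m ix2)%N = k -> m ix3 = s ->
    [/\ kapz m t = 0, kapw m t = 0 & kap3 m t = 0]) -> vanish3 t.
Proof.
move=> ht h; apply/vanish3P => m bm.
have [[h1 h2]|nm] := pselect ((m ix1 + m ix2)%N = k /\ m ix3 = s); first exact: h.
exact: kap_hom ht nm.
Qed.

Lemma toC3Z c t : toC3 (c *: t) = rc c *: toC3 t.
Proof.
case: t => [[t1 t2] t3]; congr (_, _, _); apply/mpolyP => m;
  by rewrite mcoeffZ !mcoeff_map_mpoly /= mcoeffZ rmorphM.
Qed.

Lemma toC3_sum n (c : 'I_n -> R) (e : 'I_n -> T R) :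
  toC3 (\sum_(i < n) c i *: e i) = \sum_(i < n) rc (c i) *: toC3 (e i).
Proof.
elim/big_rec2: _ => [|i t u _ <-]; first by rewrite /map3 /fmap /= !raddf0.
by rewrite -toC3Z /map3 /= !fmapD.
Qed.

Lemma bihom3_toC3 k s t : bihom3 k s t -> bihom3 k s (toC3 t).
Proof.
move=> ht m; have [h1 h2 h3] := ht m.
by split; rewrite mcoeff_map_mpoly fmorph_eq0.
Qed.

Lemma mv2tB p q : mv2t (p - q) = mv2t p - mv2t q :> mvf R.
Proof. exact: linearB. Qed.

Lemma d1tB (p q : T R) : d1t a b (p - q) = d1t a b p - d1t a b q.
Proof. exact: linearB. Qed.

Hypothesis b0 : b != 0.

(** Reduces one bidegree to linear algebra at its exceptional monomials: independence is needed over
    the reals, but solvability only over [K], since [real_primitive] turns complex coefficients into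
    real ones. *)
Lemma bidegree_cohomology k s (es : seq (T R)) :
  (forall i : 'I_(size es), bihom3 k s es`_i) ->
  (forall i : 'I_(size es), d2t a b es`_i = 0) ->
  (forall c : nat -> R, vanish3 (\sum_(i < size es) rc (c i) *: toC3 es`_i) ->
     forall i : 'I_(size es), c i = 0) ->
  (forall q : T K, bihom3 k s q -> exists c : nat -> K,
     vanish3 (q - \sum_(i < size es) c i *: toC3 es`_i)) ->
  cohomology_is (Lam a b) (Rbi R (k, k + s)%N) 2 (rspan [seq mv2t t | t <- es]).
Proof.
move=> hes des inj surj; split.
  move=> A /rspan_mv2t[c ->]; apply/cocycle_mv2t; split; first exact: bihom3_sum.
  by rewrite linear_sum big1 // => i _; rewrite linearZ /= des scaler0.
move=> A cA; have [q qE] : exists q, A = mv2t q by case: cA => /Rbi2_mv2t.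
move: cA; rewrite {A}qE => /cocycle_mv2t[hq dq].
have [c vc] := surj _ (bihom3_toC3 hq).
have [p pE] := real_primitive iu2 reim re_rc re1 reiu b0 dq des vc.
exists (mv2t (\sum_(i < size es) re (c i) *: es`_i)); split.
  split; first by apply/rspan_mv2t; exists (fun i => re (c i)).
  have W : in_wt (k, k + s)%N (mv2t (d1t a b p)).
    apply/in_wt_mv2t; rewrite pE -[_ - _]addrC -scaleN1r; apply: bihom3_lin => //.
    exact: bihom3_sum.
  (* The primitive need not be homogeneous; its projection is, with the same differential because
     the target already has weight (k, k + s). *)
  exists (proj (k, k + s)%N (mv1t p)).
    by apply/RbiP => //; split; [apply/Rformal_proj/Rformal_mv1|exact: in_wt_proj].
  by rewrite proj_schouten ?schouten_mv1t; [rewrite proj_id // pE mv2tB|exact: Lam_wt].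
move=> B [/rspan_mv2t[c' ->] [X /Rbi1_mv1t[p' ->]]].
rewrite schouten_mv1t -mv2tB => /mv2t_inj pE'.
congr mv2t; apply: eq_bigr => i _; congr (_ *: _).
apply/eqP; rewrite eq_sym -subr_eq0; apply/eqP.
(* Two representatives of one class differ by the differential of [p - p'], on which the functionals
   vanish by [real_exact]. *)
apply: (inj (fun i => c' i - re (c i))).
have -> : \sum_(i < size es) rc (c' i - re (c i)) *: toC3 es`_i =
    toC3 (d1t a b (p - p')).
  rewrite d1tB pE pE' opprB [X in _ = toC3 X]addrC addrA subrK.
  rewrite -sumrB -toC3_sum; congr toC3; apply: eq_bigr => j _.
  by rewrite scalerBl.
exact: (real_exact rc iu2).
Qed.
End Criterion.

Section ShortSums.
Variables (A : Type) (x0 : A) (Q : A -> Prop) (V : zmodType) (G : nat -> A -> V).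

Lemma nth1P t1 : Q t1 -> forall i : 'I_(size [:: t1]), Q (nth x0 [:: t1] i).
Proof. by move=> h1 [[|//] hi]. Qed.
Lemma nth2P t1 t2 : Q t1 -> Q t2 ->
  forall i : 'I_(size [:: t1; t2]), Q (nth x0 [:: t1; t2] i).
Proof. by move=> h1 h2 [[|[|//]] hi]. Qed.
Lemma nth3P t1 t2 t3 : Q t1 -> Q t2 -> Q t3 ->
  forall i : 'I_(size [:: t1; t2; t3]), Q (nth x0 [:: t1; t2; t3] i).
Proof. by move=> h1 h2 h3 [[|[|[|//]]] hi]. Qed.

Lemma big_nth1 t1 : \sum_(i < size [:: t1]) G i (nth x0 [:: t1] i) = G 0 t1.
Proof. by rewrite !big_ord_recl big_ord0 addr0. Qed.
Lemma big_nth2 t1 t2 :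
  \sum_(i < size [:: t1; t2]) G i (nth x0 [:: t1; t2] i) = G 0 t1 + G 1 t2.
Proof. by rewrite !big_ord_recl big_ord0 addr0. Qed.
Lemma big_nth3 t1 t2 t3 : \sum_(i < size [:: t1; t2; t3]) G i (nth x0 [:: t1; t2;
    t3] i) =
  G 0 t1 + G 1 t2 + G 2 t3.
Proof. by rewrite !big_ord_recl big_ord0 addr0 addrA. Qed.
End ShortSums.

Lemma mpolyCnat (A : comNzRingType) k : (k%:R)%:MP_[3] = k%:R :> {mpoly A[3]}.
Proof. exact: rmorph_nat. Qed.

(** * The three families of exceptional bidegrees *)

Section Classes.
Variables (R : realType) (K : fieldType) (rc : {rmorphism R -> K})
  (re im : {additive K -> R}) (iu : K).
Hypothesis iu2 : iu * iu = -1.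
Hypothesis reim : forall z, z = rc (re z) + iu * rc (im z).
Hypothesis re_rc : forall z x, re (z * rc x) = re z * x.
Hypothesis re1 : re 1 = 1.
Hypothesis reiu : re iu = 0.
Local Notation P K := {mpoly K[3]}.
Local Notation T K := (P K * P K * P K)%type.
Variables a b : R.
Hypothesis b0 : b != 0.
Local Notation toC3 := (map3 rc).
Local Notation toC := (fmap rc).
Local Notation psi := (psi iu).
Local Notation phi := (phi iu).
Local Notation kapz := (kapz iu).
Local Notation kapw := (kapw iu).
Local Notation kap3 := (kap3 iu).
Let phiK := phiK iu2 (two_neq0 rc).
Let I2 : (iu%:MP_[3] : P K) * iu%:MP = -1 := mpC_iu2 iu2.
Let RI0 := @reim_eq0 R K rc re iu iu2 re_rc re1 reiu.

Definition Dp : P R := (x1 ^+ 2 + x2 ^+ 2) * x3.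
Definition Y23t : T R := (x1 * x3, x2 * x3, 0).
Definition Y31t : T R := (- x2 * x3, x1 * x3, 0).
Definition Y12t : T R := (0, 0, x1 ^+ 2 + x2 ^+ 2).
Definition esA n := [:: mulT (Dp ^+ n) Y23t; mulT (Dp ^+ n) Y31t; mulT (Dp ^+ n) Y12t].
(* The exponent of D^(n+1) = (z z' x3)^(n+1). *)
Definition muA n : 'X_{1..3} := ((U_(ix1) + U_(ix2) + U_(ix3)) *+ n.+1)%MM.

Lemma muAE n i : muA n i = n.+1.
Proof. by move: i; apply: ord3P; rewrite mulmnE !mnmDE !mnm1E /= ?mul1n. Qed.

(** D is the monomial z z' x3, so multiplication by D^n only shifts exponents in the new
    variables. *)
Lemma toC_Dp n : toC (Dp ^+ n) = phi ((x1 * x2 * x3) ^+ n).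
Proof.
have fX (p : P R) : toC (p ^+ n) = toC p ^+ n by exact: rmorphXn.
have pX (p : P K) : phi (p ^+ n) = phi p ^+ n by rewrite /phi rmorphXn.
rewrite fX pX; congr (_ ^+ n); rewrite /Dp !expr2 !(phiM, phiX1, phiX2, phiX3).
rewrite fmapM fmapD !fmapM !fmapX; ring: I2.
Qed.

Lemma psi_toC_Dp n p : psi (toC (Dp ^+ n) * p) = (x1 * x2 * x3) ^+ n * psi p.
Proof. by rewrite psiM toC_Dp phiK. Qed.

Lemma mcoeff_muA n : ((x1 * x2 * x3 : P K) * (x1 * x2 * x3) ^+ n)@_(muA n) = 1.
Proof. by rewrite -exprS -!mpolyXD mpolyXn mcoeffX eqxx. Qed.

Lemma kapA n (t : T R) :
  [/\ kapz (muA n) (toC3 (mulT (Dp ^+ n) t)) =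
        (x2 * ((x1 * x2 * x3) ^+ n * psi (toC t.1.1 + iu%:MP * toC t.1.2)))@_(muA n),
      kapw (muA n) (toC3 (mulT (Dp ^+ n) t)) =
        (x1 * ((x1 * x2 * x3) ^+ n * psi (toC t.1.1 - iu%:MP * toC t.1.2)))@_(muA n)
    & kap3 (muA n) (toC3 (mulT (Dp ^+ n) t)) =
        (x3 * ((x1 * x2 * x3) ^+ n * psi (toC t.2)))@_(muA n)].
Proof.
rewrite /kapz /kapw /kap3 /Gz /Gw /G3 /map3 /mulT /= !fmapM.
rewrite ![iu%:MP_[3] * (toC (Dp ^+ n) * _)]mulrCA -mulrBr -mulrDr.
by split; rewrite psi_toC_Dp.
Qed.

(** Y_23 /\ Y_1 = Y_31 /\ Y_2 = Y_12 /\ Y_3 = D d1 /\ d2 /\ d3, and the other products of this kind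
    vanish. So here g_1 = D^(n+1) and g_2 = g_3 = 0; the next two lemmas are alike. *)
Lemma kapA_Y23 n : [/\ kapz (muA n) (toC3 (mulT (Dp ^+ n) Y23t)) = 1,
  kapw (muA n) (toC3 (mulT (Dp ^+ n) Y23t)) = 1
  & kap3 (muA n) (toC3 (mulT (Dp ^+ n) Y23t)) = 0].
Proof.
have [-> -> ->] := kapA n Y23t; rewrite /= fmap0 psi0 !mulr0 mcoeff0; split=> //.
- rewrite (_ : _ + _ = phi (x1 * x3)); last by rewrite !fmapM !fmapX phiM phiX1 phiX3;
    ring.
  by rewrite phiK -[RHS](mcoeff_muA n); congr (_@__); ring.
- rewrite (_ : _ - _ = phi (x2 * x3)); last by rewrite !fmapM !fmapX phiM phiX2 phiX3;
    ring.
  by rewrite phiK -[RHS](mcoeff_muA n); congr (_@__); ring.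
Qed.

Lemma kapA_Y31 n : [/\ kapz (muA n) (toC3 (mulT (Dp ^+ n) Y31t)) = iu,
  kapw (muA n) (toC3 (mulT (Dp ^+ n) Y31t)) = - iu
  & kap3 (muA n) (toC3 (mulT (Dp ^+ n) Y31t)) = 0].
Proof.
have [-> -> ->] := kapA n Y31t; rewrite /= fmap0 psi0 !mulr0 mcoeff0; split=> //.
- rewrite (_ : _ + _ = phi (iu%:MP * (x1 * x3))); last first.
    rewrite !fmapM fmapN !fmapX !phiM phiC phiX1 phiX3; ring: I2.
  rewrite phiK -[RHS]mulr1 -(mcoeff_muA n) -mcoeffCM; congr (_@__); ring.
- rewrite (_ : _ - _ = phi ((- iu)%:MP * (x2 * x3))); last first.
    rewrite !fmapM fmapN !fmapX !phiM phiC phiX2 phiX3 mpolyCN; ring: I2.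
  rewrite phiK -[RHS]mulr1 -(mcoeff_muA n) -mcoeffCM; congr (_@__); ring.
Qed.

Lemma kapA_Y12 n : [/\ kapz (muA n) (toC3 (mulT (Dp ^+ n) Y12t)) = 0,
  kapw (muA n) (toC3 (mulT (Dp ^+ n) Y12t)) = 0
  & kap3 (muA n) (toC3 (mulT (Dp ^+ n) Y12t)) = 1].
Proof.
have [-> -> ->] := kapA n Y12t; rewrite /= fmap0 !mulr0 addr0 subr0 psi0 !mulr0 mcoeff0.
split=> //; rewrite (_ : toC _ = phi (x1 * x2)); last first.
  rewrite !expr2 fmapD !fmapM !fmapX phiM phiX1 phiX2; ring: I2.
by rewrite phiK -[RHS](mcoeff_muA n); congr (_@__); ring.
Qed.

Lemma dE_exp (p : P R) n : dE (p ^+ n) = (p ^+ n.-1 * dE p) *+ n.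
Proof.
case: n => [|n]; first by rewrite expr0 /dE -mpolyC1 !mderivC !mulr0 addr0.
elim: n => [|n IH]; first by rewrite !expr1 expr0 mul1r.
rewrite exprS {1}/dE !mderivM.
rewrite (_ : _ + _ = p ^+ n.+1 * dE p + p * dE (p ^+ n.+1)); last by rewrite /dE; ring.
by rewrite IH /= [RHS]mulrS; congr (_ + _); rewrite mulrnAr mulrA -exprS.
Qed.
Lemma dJ_exp (p : P R) n : dJ (p ^+ n) = (p ^+ n.-1 * dJ p) *+ n.
Proof.
case: n => [|n]; first by rewrite expr0 /dJ -mpolyC1 !mderivC !mulr0 subr0.
elim: n => [|n IH]; first by rewrite !expr1 expr0 mul1r.
rewrite exprS {1}/dJ !mderivM.
rewrite (_ : _ - _ = p ^+ n.+1 * dJ p + p * dJ (p ^+ n.+1)); last by rewrite /dJ; ring.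
by rewrite IH /= [RHS]mulrS; congr (_ + _); rewrite mulrnAr mulrA -exprS.
Qed.
Lemma dT_exp (p : P R) n : dT (p ^+ n) = (p ^+ n.-1 * dT p) *+ n.
Proof.
case: n => [|n]; first by rewrite expr0 /dT -mpolyC1 !mderivC !mulr0.
elim: n => [|n IH]; first by rewrite !expr1 expr0 mul1r.
rewrite exprS {1}/dT mderivM.
rewrite (_ : x3 * _ = p ^+ n.+1 * dT p + p * dT (p ^+ n.+1)); last by rewrite /dT; ring.
by rewrite IH /= [RHS]mulrS; congr (_ + _); rewrite mulrnAr mulrA -exprS.
Qed.

(** Leibniz rule: the correction is minus the sum of X_i(p) times the scalar t /\ Y_i. *)
Lemma d2t_mulT p (t : T R) : d2t a b (mulT p t) = p * d2t a b t
  + (x3 * (2 * b%:MP * dJ p - a%:MP * dE p) * t.2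
     + 2 * b%:MP * dT p * (x2 * t.1.1 - x1 * t.1.2) + a%:MP * dT p * (x1 * t.1.1 + x2 *
         t.1.2)
     + b%:MP * (dE p * (x1 * t.1.2 - x2 * t.1.1) - dJ p * (x1 * t.1.1 + x2 * t.1.2))).
Proof.
case: t => [[q1 q2] q3]; rewrite /d2t /mulT /= /d2 /dE /dJ /dT !mderivE; ring.
Qed.

Lemma d2_Y23 : d2t a b Y23t = 0.
Proof.
rewrite -[LHS]/(d2 a b (x1 * x3) (x2 * x3) 0) /d2 /dE /dJ /dT.
rewrite !mderivE ?mderiv0 /=; ring.
Qed.
Lemma d2_Y31 : d2t a b Y31t = 0.
Proof.
rewrite -[LHS]/(d2 a b (- x2 * x3) (x1 * x3) 0) /d2 /dE /dJ /dT.
rewrite !mderivE ?mderiv0 /=; ring.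
Qed.
Lemma d2_Y12 : d2t a b Y12t = 0.
Proof.
rewrite -[LHS]/(d2 a b 0 0 (x1 ^+ 2 + x2 ^+ 2)) /d2 /dE /dJ /dT.
rewrite !expr2 !mderivE ?mderiv0 /=; ring.
Qed.

(** Since X_2 D = 0, X_1 D = - a D and X_3 D = 2a D, the Leibniz correction for D^n is a multiple of
    a n. *)
Lemma d2_esA n : a = 0 \/ n = 0%N -> forall i : 'I_(size (esA n)),
    d2t a b (esA n)`_i = 0.
Proof.
move=> an.
pose c : P R := n%:R.
have an0 : a%:MP * c = 0.
  by rewrite /c; case: an => ->; rewrite ?mulr0 // mpolyC0 mul0r.
have hE : dE (Dp ^+ n) = 2 * Dp ^+ n * c.
  rewrite dE_exp /c; case: n {an an0 c} => [|n]; rewrite ?mulr0n ?mulr0 //= exprS.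
  rewrite (_ : dE Dp = 2 * Dp); last by rewrite /Dp /dE !expr2 !mderivE /=; ring.
  by rewrite mulr_natr; congr (_ *+ _); ring.
have hJ : dJ (Dp ^+ n) = 0.
  rewrite dJ_exp (_ : dJ Dp = 0) ?mulr0 ?mul0rn //.
  by rewrite /Dp /dJ !expr2 !mderivE /=; ring.
have hT : dT (Dp ^+ n) = Dp ^+ n * c.
  rewrite dT_exp /c; case: n {an an0 c hE hJ} => [|n]; rewrite ?mulr0n ?mulr0 //= exprS.
  rewrite (_ : dT Dp = Dp); last by rewrite /Dp /dT !expr2 !mderivE /=; ring.
  by rewrite mulr_natr; congr (_ *+ _); ring.
have key t : d2t a b t = 0 -> d2t a b (mulT (Dp ^+ n) t) = 0.
  move=> ht; rewrite d2t_mulT ht hE hJ hT.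
  transitivity (a%:MP * c * Dp ^+ n * (x1 * t.1.1 + x2 * t.1.2 - 2 * x3 * t.2));
      last first.
    by rewrite an0 !mul0r.
  move: (Dp ^+ n) (c) t.1.1 t.1.2 t.2 => p d q1 q2 q3; ring.
exact: (@nth3P (T R) 0 (fun t : T R => d2t a b t = 0) _ _ _
         (key _ d2_Y23) (key _ d2_Y31) (key _ d2_Y12)).
Qed.

Lemma bihom_Dp n : bihom (2 * n) n (Dp ^+ n).
Proof.
have := @bihomX _ 2 1 Dp n; rewrite mul1n; apply.
apply: (@bihomM _ 2 0 0 1) (@bihom_x3 R).
by apply: bihomD; [exact: (@bihomX _ 1 0 _ 2 (@bihom_x1 R))|exact: (@bihomX _ 1 0 _ 2
    (@bihom_x2 R))].
Qed.

Local Notation vanish3 := (vanish3 iu a).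
Local Notation L := (Lam a b).

Lemma bihom3_sub k s n (q : T K) (c : 'I_n -> K) (e : 'I_n -> T R) :
  bihom3 k s q -> (forall i, bihom3 k s (e i)) ->
  bihom3 k s (q - \sum_(i < n) c i *: toC3 (e i)).
Proof.
move=> hq he; rewrite -[_ - _]addrC -scaleN1r; apply: bihom3_lin => //.
by apply: bihom3_sum => i; exact: bihom3_toC3.
Qed.

Lemma half2 : (2 : K) * 2^-1 = 1. Proof. by rewrite mulfV // (two_neq0 rc). Qed.

(** With [solve_w]: c0 = (z + w) / 2 and c1 = - i (z - w) / 2 solve c0 + i c1 = z, c0 - i c1 = w. *)
Lemma solve_z (z w : K) :
  z - (2^-1 * (z + w) + - (2^-1 * iu * (z - w)) * iu) = 0.
Proof.
have := half2; move: (2^-1) => h h2.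
transitivity ((1 - 2 * h) * z + h * (z - w) * (iu * iu + 1)); first by ring.
by rewrite h2 iu2 addNr subrr mul0r mulr0 addr0.
Qed.
Lemma solve_w (z w : K) :
  w - (2^-1 * (z + w) - - (2^-1 * iu * (z - w)) * iu) = 0.
Proof.
have := half2; move: (2^-1) => h h2.
transitivity ((1 - 2 * h) * w - h * (z - w) * (iu * iu + 1)); first by ring.
by rewrite h2 iu2 addNr subrr mul0r mulr0 subr0.
Qed.

Lemma cohomology_A n : a = 0 \/ n = 0%N ->
  cohomology_is L (Rbi R (2 * n.+1,
      2 * n.+1 + n.+1)%N) 2 (rspan [seq mv2t t | t <- esA n]).
Proof.
move=> an.
have key t : bihom 1 1 t.1.1 -> bihom 1 1 t.1.2 -> bihom 2 0 t.2 ->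
    bihom3 (2 * n.+1) n.+1 (mulT (Dp ^+ n) t).
  move=> h1 h2 h3 m; have hD := @bihom_Dp n; split=> /= hm.
  - by have [e1 e2] := bihomM hD h1 hm; lia.
  - by have [e1 e2] := bihomM hD h2 hm; lia.
  - by have [e1 e2] := bihomM hD h3 hm; lia.
have hx13 : bihom 1 1 (x1 * x3 : P R) := @bihomM _ 1 0 0 1 _ _ (@bihom_x1 R) (@bihom_x3
    R).
have hx23 : bihom 1 1 (x2 * x3 : P R) := @bihomM _ 1 0 0 1 _ _ (@bihom_x2 R) (@bihom_x3
    R).
have hes : forall i : 'I_(size (esA n)), bihom3 (2 * n.+1) n.+1 (esA n)`_i.
  apply: (@nth3P (T R) 0 (bihom3 (2 * n.+1) n.+1)); apply: key; rewrite /=;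
    try exact: hx13; try exact: hx23; try exact: bihom0.
    by rewrite mulNr; exact: bihomN.
  by apply: bihomD; [exact: (@bihomX _ 1 0 _ 2 (@bihom_x1 R))|exact: (@bihomX _ 1 0 _ 2
      (@bihom_x2 R))].
have bmu : bad a (muA n).
  by apply: Or41; rewrite !muAE; split=> //; case: an => [->|->]; [left|right].
have [z1 w1 u1] := kapA_Y23 n; have [z2 w2 u2] := kapA_Y31 n.
have [z3 w3 u3] := kapA_Y12 n.
have E (c : nat -> K) :
  [/\ kapz (muA n) (\sum_(i < size (esA n)) c i *: toC3 (esA n)`_i) = c 0 + c 1 * iu,
     kapw (muA n) (\sum_(i < size (esA n)) c i *: toC3 (esA n)`_i) = c 0 - c 1 * iu
   & kap3 (muA n) (\sum_(i < size (esA n)) c i *: toC3 (esA n)`_i) = c 2].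
  rewrite kapz_sum kapw_sum kap3_sum; split.
  - rewrite (@big_nth3 _ 0 _ (fun i t => c i * kapz (muA n) (toC3 t))) z1 z2 z3; ring.
  - rewrite (@big_nth3 _ 0 _ (fun i t => c i * kapw (muA n) (toC3 t))) w1 w2 w3; ring.
  - rewrite (@big_nth3 _ 0 _ (fun i t => c i * kap3 (muA n) (toC3 t))) u1 u2 u3; ring.
apply: (bidegree_cohomology iu2 reim re_rc re1 reiu b0) => //.
- exact: d2_esA.
(* The coefficients are real, so the single equation c 0 + i c 1 = 0 already kills both. *)
- move=> c /vanish3P/(_ _ bmu)[].
  have [-> _ ->] := E (fun i => rc (c i)); move=> h _ /eqP.
  rewrite fmorph_eq0 => /eqP c2; move: h; rewrite mulrC => /RI0[c0 c1].
  by move=> [[|[|[|//]]] hi].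
- move=> q hq; pose z : K := kapz (muA n) q; pose w : K := kapw (muA n) q.
  pose u : K := kap3 (muA n) q.
  pose c := nth 0 [:: 2^-1 * (z + w); - (2^-1 * iu * (z - w)); u]; exists c.
  have hh := @bihom3_sub _ _ _ q (fun i : 'I_(size (esA n)) => c i) _ hq hes.
  apply: (vanish3_hom hh) => m bm e1 e2.
  (* The other exceptional monomials have degree 0 in x3 or in z, z', so they do not occur at
     degrees 2n + 2 and n + 1. *)
  have -> : m = muA n.
    apply/mnmP => i; rewrite muAE; move: i.
    case: bm => [[m3 h1 h2 _]|[_ h1 h2 h3]|[_ h1 h2 h3]|[_ h1 h2 h3]]; try lia.
    by apply: ord3P; lia.
  rewrite kapzB kapwB kap3B -/z -/w -/u.
  have [-> -> ->] := E c; rewrite {hh}/c.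
  by split; [exact: solve_z|exact: solve_w|exact: subrr].
Qed.

(** This is the criterion applied to the empty list of representatives. *)
Lemma exact_off k s : (forall m : 'X_{1..3},
    bad a m -> (m ix1 + m ix2)%N = k -> m ix3 <> s) ->
  forall A, cocycles L (Rbi R (k, k + s)%N) 2 A -> coboundaries L (Rbi R (k,
      k + s)%N) 2 A.
Proof.
move=> off A cA.
have H : cohomology_is L (Rbi R (k,
    k + s)%N) 2 (rspan [seq mv2t t | t <- [::] : seq (T R)]).
  apply: (bidegree_cohomology iu2 reim re_rc re1 reiu b0) => [[]//|[]//|c _ []//|q hq].
  exists (fun=> 0); rewrite big_ord0 subr0.
  by apply: (vanish3_hom hq) => m bm e1 e2; case: (off m bm e1 e2).
case: H => _ /(_ A cA)[B [[[c ->] h] _]]; move: h; rewrite big_ord0 subr0.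
exact.
Qed.

Lemma exp_neq0 n : (2^-1 : K) ^+ n != 0.
Proof. by rewrite expf_neq0 // invr_eq0 (two_neq0 rc). Qed.

Lemma coef_z0 (p : P K) n : (x1 * p)@_(U_(ix2) *+ n) = 0.
Proof. by rewrite mcoeff_XM mulmnE mnm1E. Qed.
Lemma coef_zS (p : P K) n : (x2 * p)@_(U_(ix2) *+ n.+1) = p@_(U_(ix2) *+ n).
Proof.
rewrite mcoeff_XM mulmnE mnm1E eqxx mul1n /=; congr (_@__).
by apply/mnmP => i; rewrite mnmBE !mulmnE mulnS addKn.
Qed.
Lemma coef_w0 (p : P K) n : (x2 * p)@_(U_(ix1) *+ n) = 0.
Proof. by rewrite mcoeff_XM mulmnE mnm1E. Qed.
Lemma coef_wS (p : P K) n : (x1 * p)@_(U_(ix1) *+ n.+1) = p@_(U_(ix1) *+ n).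
Proof.
rewrite mcoeff_XM mulmnE mnm1E eqxx mul1n /=; congr (_@__).
by apply/mnmP => i; rewrite mnmBE !mulmnE mulnS addKn.
Qed.
Lemma coef_3S (p : P K) n : (x3 * p)@_(U_(ix3) *+ n.+1) = p@_(U_(ix3) *+ n).
Proof.
rewrite mcoeff_XM mulmnE mnm1E eqxx mul1n /=; congr (_@__).
by apply/mnmP => i; rewrite mnmBE !mulmnE mulnS addKn.
Qed.

(** The generators for m = n + 1. At n = 0 the truncated exponent [n.-1] is harmless because of the
    factor n. *)
Definition esB n : seq (T R) :=
  [:: (x1 ^+ n, 0, 0); (n%:R * x1 ^+ n.-1 * x2, x1 ^+ n, 0)].

Let hsum n : P K := (2^-1%:MP * (x1 + x2)) ^+ n.

Lemma psi_x1n n : psi (x1 ^+ n) = hsum n.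
Proof. by rewrite {1}/psi rmorphXn /=; congr (_ ^+ n); exact: psiX1. Qed.

Lemma toC_x1n n : toC (x1 ^+ n) = x1 ^+ n.
Proof. by rewrite /fmap rmorphXn /=; congr (_ ^+ n); exact: fmapX. Qed.

Lemma hsum_z n : (hsum n)@_(U_(ix2) *+ n) = 2^-1 ^+ n.
Proof.
elim: n => [|n IH]; first by rewrite /hsum !expr0 mcoeff1 mulm0n eqxx.
by rewrite /hsum exprS -mulrA mcoeffCM mulrDl mcoeffD coef_z0 add0r coef_zS IH exprS.
Qed.
Lemma hsum_w n : (hsum n)@_(U_(ix1) *+ n) = 2^-1 ^+ n.
Proof.
elim: n => [|n IH]; first by rewrite /hsum !expr0 mcoeff1 mulm0n eqxx.
by rewrite /hsum exprS -mulrA mcoeffCM mulrDl mcoeffD coef_w0 addr0 coef_wS IH exprS.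
Qed.

(** Only the pure powers in x1^n = ((z + z') / 2)^n count, each with coefficient 2^-n. *)
Lemma kapB_1 n : kapz (U_(ix2) *+ n.+1) (toC3 (x1 ^+ n, 0, 0)) = 2^-1 ^+ n /\
  kapw (U_(ix1) *+ n.+1) (toC3 (x1 ^+ n, 0, 0)) = 2^-1 ^+ n.
Proof.
rewrite /kapz /kapw /Gz /Gw /= toC_x1n fmap0 mulr0 addr0 subr0 psi_x1n.
by rewrite coef_zS coef_wS hsum_z hsum_w.
Qed.

Lemma psi_nat n : psi n%:R = n%:R. Proof. by rewrite /psi rmorph_nat. Qed.

(** As x2 = - i (z - z') / 2, at z'^n the term n x1^(n-1) x2 gives i n 2^-n and i x1^n gives i 2^-n.
    The value at z^n is the conjugate. *)
Lemma kapB_2 n : let t := (n%:R * x1 ^+ n.-1 * x2, x1 ^+ n, 0) in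
  kapz (U_(ix2) *+ n.+1) (toC3 t) = iu * n.+1%:R * 2^-1 ^+ n /\
  kapw (U_(ix1) *+ n.+1) (toC3 t) = - (iu * n.+1%:R * 2^-1 ^+ n).
Proof.
rewrite /kapz /kapw /Gz /Gw /= !fmapM !toC_x1n fmapX (_ : toC n%:R = n%:R);
    last exact: rmorph_nat.
rewrite coef_zS coef_wS !(psiD, psiN, psiM, psiC) psi_x1n psi_nat psi_x1n psiX2.
rewrite mcoeffD mcoeffB !mcoeffCM hsum_z hsum_w.
case: n => [|n]; first by rewrite !mul0r !mcoeff0 add0r sub0r expr0 !mulr1.
rewrite (_ : n.+1%:R * hsum n.+1.-1 * _ =
    (n.+1%:R * (iu / 2))%:MP * (x2 * hsum n - x1 * hsum n)).
  rewrite !mcoeffCM !mcoeffB coef_zS coef_z0 coef_wS coef_w0 hsum_z hsum_w exprS.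
  by rewrite -[n.+2%:R]natr1; split; ring: half2.
rewrite [X in _ = X * _]mpolyCM mpolyCnat -[n.+1.-1]/n.
move: (hsum n) (iu / 2)%:MP (n.+1%:R : P K) => y i c; ring.
Qed.

Lemma mderiv_x1n n : [/\ (x1 ^+ n : P R)^`M(ix1) = n%:R * x1 ^+ n.-1,
  (x1 ^+ n : P R)^`M(ix2) = 0 & (x1 ^+ n : P R)^`M(ix3) = 0].
Proof.
elim: n => [|n [h1 h2 h3]]; first by rewrite expr0 -mpolyC1 !mderivC mul0r.
rewrite exprS !mderivM !mderivXU h1 h2 h3 /=; split; try ring.
by case: n {h1 h2 h3} => [|n]; rewrite /= ?mul0r ?mulr0 ?expr0 -?natr1 ?exprS; ring.
Qed.

Lemma d2_esB n : a = 0 -> forall i : 'I_(size (esB n)), d2t a b (esB n)`_i = 0.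
Proof.
move=> a0; apply: (@nth2P (T R) 0 (fun t : T R => d2t a b t = 0)); rewrite a0.
- rewrite -[LHS]/(d2 0 b (x1 ^+ n) 0 0) /d2 /dE /dJ /dT mpolyC0.
  have [h1 h2 h3] := mderiv_x1n n.
  rewrite !mderivE ?mderiv0 /= h1 h2 h3.
  move: (x1 ^+ n.-1 : P R) (n%:R : P R) => y c; ring.
- rewrite -[LHS]/(d2 0 b (n%:R * x1 ^+ n.-1 * x2) (x1 ^+ n) 0) /d2 /dE /dJ /dT mpolyC0.
  have [h1 h2 h3] := mderiv_x1n n; have [k1 k2 k3] := mderiv_x1n n.-1.
  have mn j : (n%:R : P R)^`M(j) = 0 by rewrite -mpolyCnat mderivC.
  rewrite !mderivE ?mderiv0 /= ?mn h1 h2 h3 k1 k2 k3.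
  case: n {h1 h2 h3 k1 k2 k3 mn} => [|[|n]] /=; rewrite ?exprS ?expr0; ring.
Qed.

Lemma solve_zB (z w h N : K) : h != 0 -> N != 0 ->
  z - (2^-1 * (z + w) / h + iu * (- (2^-1 * iu * (z - w) / h / N) * N)) * h = 0.
Proof.
move=> h0 N0; rewrite -[RHS](solve_z z w); move: (2^-1) => x; field.
by rewrite h0 N0.
Qed.
Lemma solve_wB (z w h N : K) : h != 0 -> N != 0 ->
  w - (2^-1 * (z + w) / h - iu * (- (2^-1 * iu * (z - w) / h / N) * N)) * h = 0.
Proof.
move=> h0 N0; rewrite -[RHS](solve_w z w); move: (2^-1) => x; field.
by rewrite h0 N0.
Qed.

(** The monomials z^(n+1) and z'^(n+1) share this bidegree, hence two classes. They are conjugate,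
    so independence over the reals is seen at z'^(n+1) alone. *)
Lemma cohomology_B n : a = 0 ->
  cohomology_is L (Rbi R (n.+1, n.+1 + 0)%N) 2 (rspan [seq mv2t t | t <- esB n]).
Proof.
move=> a0.
have hx1n k : bihom k 0 (x1 ^+ k : P R) by have := @bihomX _ 1 0 _ k (@bihom_x1 R);
    rewrite mul1n.
have hes : forall i : 'I_(size (esB n)), bihom3 n.+1 0 (esB n)`_i.
  apply: (@nth2P (T R) 0 (bihom3 n.+1 0)); apply: bihom3P => //= n0 [->]; split;
      try exact: hx1n; try exact: bihom0.
  case: n => [|k] /=; first by rewrite !mul0r; exact: bihom0.
  have := @bihomM _ 0 0 _ _ _ _ (@bihomC R k.+1%:R) (@bihomM _ k 0 1 0 _ _ (hx1n k)
      (@bihom_x2 R)).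
  by rewrite mpolyCnat mulrA addn1.
have bz : bad a (U_(ix2) *+ n.+1) by apply: Or42; rewrite !mulmnE !mnm1E.
have bw : bad a (U_(ix1) *+ n.+1) by apply: Or43; rewrite !mulmnE !mnm1E.
have [z1 w1] := kapB_1 n; have [z2 w2] := kapB_2 n.
have n0 := exp_neq0 n; have n1 : n.+1%:R != 0 :> K by rewrite -(rmorph_nat rc)
    fmorph_eq0 pnatr_eq0.
have E (c : nat -> K) :
  kapz (U_(ix2) *+ n.+1) (\sum_(i < size (esB n)) c i *: toC3 (esB n)`_i)
    = (c 0 + iu * (c 1 * n.+1%:R)) * 2^-1 ^+ n /\
  kapw (U_(ix1) *+ n.+1) (\sum_(i < size (esB n)) c i *: toC3 (esB n)`_i)
    = (c 0 - iu * (c 1 * n.+1%:R)) * 2^-1 ^+ n.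
  rewrite kapz_sum kapw_sum; split.
  - rewrite (@big_nth2 _ 0 _ (fun i t => c i * kapz (U_(ix2) *+ n.+1) (toC3 t))) z1 z2;
      ring.
  - rewrite (@big_nth2 _ 0 _ (fun i t => c i * kapw (U_(ix1) *+ n.+1) (toC3 t))) w1 w2;
      ring.
apply: (bidegree_cohomology iu2 reim re_rc re1 reiu b0) => //.
- exact: d2_esB.
- move=> c /vanish3P/(_ _ bz)[].
  have [-> _] := E (fun i => rc (c i)).
  move=> /eqP; rewrite mulf_eq0 (negbTE n0) orbF -(rmorph_nat rc) -rmorphM =>
      /eqP/RI0[c0 /eqP].
  rewrite mulf_eq0 pnatr_eq0 orbF => /eqP c1 _ _.
  by move=> [[|[|//]] hi].
- move=> q hq; pose z : K := kapz (U_(ix2) *+ n.+1) q;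
    pose w : K := kapw (U_(ix1) *+ n.+1) q.
  pose h : K := 2^-1 ^+ n; pose N : K := n.+1%:R.
  pose c := nth 0 [:: 2^-1 * (z + w) / h; - (2^-1 * iu * (z - w) / h / N)].
  have hh := @bihom3_sub _ _ _ q (fun i : 'I_(size (esB n)) => c i) _ hq hes.
  exists c; apply: (vanish3_hom hh) => m bm e1 e2.
  have [Ez Ew] := E c.
  have hz : kapz (U_(ix2) *+ n.+1) (q - \sum_(i < size (esB n)) c i *: toC3 (esB n)`_i)
      = 0.
    by rewrite kapzB Ez; exact: solve_zB.
  have hw : kapw (U_(ix1) *+ n.+1) (q - \sum_(i < size (esB n)) c i *: toC3 (esB n)`_i)
      = 0.
    by rewrite kapwB Ew; exact: solve_wB.
  case: bm => [[m3 h1 h2 _]|[_ h1 h2 h3]|[_ h1 h2 h3]|[_ h1 h2 h3]]; try lia.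
  + have mE : m = (U_(ix2) *+ n.+1)%MM.
      by apply/mnmP; apply: ord3P; rewrite mulmnE mnm1E /= ?mul1n ?mul0n //; lia.
    by split; [rewrite mE|rewrite /kapw /Gw mcoeff_XM h1|rewrite /kap3 /G3 mcoeff_XM
        e2].
  + have mE : m = (U_(ix1) *+ n.+1)%MM.
      by apply/mnmP; apply: ord3P; rewrite mulmnE mnm1E /= ?mul1n ?mul0n //; lia.
    by split; [rewrite /kapz /Gz mcoeff_XM h1|rewrite mE|rewrite /kap3 /G3 mcoeff_XM
        e2].
Qed.

(** With degree 0 in z, z' only g_3 survives and x3^(n+1) is the only monomial: one functional, one
    class. *)
Lemma cohomology_C n : a = 0 -> cohomology_is L (Rbi R (0, 0 + n.+1)%N) 2
  (rspan [seq mv2t t | t <- [:: (0, 0, x3 ^+ n) : T R]]).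
Proof.
move=> a0.
have hes : forall i : 'I_(size [:: (0, 0, x3 ^+ n) : T R]),
    bihom3 0 n.+1 ([:: (0, 0, x3 ^+ n) : T R]`_i).
  apply: (@nth1P (T R) 0 (bihom3 0 n.+1)); apply: bihom3P => //= n0 [->].
  by have := @bihomX _ 0 1 _ n (@bihom_x3 R); rewrite mul0n mul1n.
have bu : bad a (U_(ix3) *+ n.+1) by apply: Or44; rewrite !mulmnE !mnm1E.
have u1 : kap3 (U_(ix3) *+ n.+1) (toC3 ((0, 0, x3 ^+ n) : T R)) = 1.
  have fX : toC (x3 ^+ n) = x3 ^+ n by rewrite /fmap rmorphXn /=; congr (_ ^+ n);
      exact: fmapX.
  have pX : psi (x3 ^+ n) = x3 ^+ n by rewrite {1}/psi rmorphXn /=; congr (_ ^+ n);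
      exact: psiX3.
  by rewrite /kap3 /G3 /= fX pX coef_3S mpolyXn mcoeffX eqxx.
have E (c : nat -> K) : kap3 (U_(ix3) *+ n.+1) (\sum_(i < size [:: (0, 0,
    x3 ^+ n) : T R])
    c i *: toC3 ([:: (0, 0, x3 ^+ n) : T R]`_i)) = c 0.
  rewrite kap3_sum (@big_nth1 _ 0 _ (fun i t => c i * kap3 (U_(ix3) *+ n.+1) (toC3 t))).
  by rewrite u1 mulr1.
apply: (bidegree_cohomology iu2 reim re_rc re1 reiu b0) => //.
- apply: (@nth1P (T R) 0 (fun t : T R => d2t a b t = 0)); rewrite a0.
  have hE : dE (x3 ^+ n : P R) = 0.
    by rewrite dE_exp /dE !mderivXU /= !mulr0 addr0 mulr0 mul0rn.
  have hJ : dJ (x3 ^+ n : P R) = 0.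
    by rewrite dJ_exp /dJ !mderivXU /= !mulr0 subr0 mulr0 mul0rn.
  rewrite -[LHS]/(d2 0 b 0 0 (x3 ^+ n)) /d2 hE hJ /dE /dJ /dT mpolyC0 !mulr0 ?subrr
      ?addr0 !mderiv0.
  by move: (x3 ^+ n : P R) => y; ring.
- move=> c /vanish3P/(_ _ bu)[_ _]; have -> := E (fun i => rc (c i)).
  by move=> /eqP; rewrite fmorph_eq0 => /eqP c0 [[|//] hi].
- move=> q hq; pose u : K := kap3 (U_(ix3) *+ n.+1) q; exists (fun=> u).
  have hh := @bihom3_sub _ _ _ q (fun i : 'I_(size [:: (0, 0,
      x3 ^+ n) : T R]) => u) _ hq hes.
  apply: (vanish3_hom hh) => m bm e1 e2.
  have mE : m = (U_(ix3) *+ n.+1)%MM.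
    by apply/mnmP; apply: ord3P; rewrite mulmnE mnm1E /= ?mul1n ?mul0n //; lia.
  split; [rewrite /kapz /Gz mcoeff_XM mE|rewrite /kapw /Gw mcoeff_XM mE|];
    rewrite ?mulmnE ?mnm1E //=.
  by rewrite mE kap3B (E (fun=> u)) subrr.
Qed.
End Classes.

Section ComplexNumbers.
Variable R : realType.

Definition re_part (z : R[i]) : R := complex.Re z.
Definition im_part (z : R[i]) : R := complex.Im z.
Lemma re_part_is_additive : additive re_part.
Proof. by move=> [? ?] [? ?]. Qed.
Lemma im_part_is_additive : additive im_part.
Proof. by move=> [? ?] [? ?]. Qed.
HB.instance Definition _ := GRing.isAdditive.Build R[i] R re_part re_part_is_additive.
HB.instance Definition _ := GRing.isAdditive.Build R[i] R im_part im_part_is_additive.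

(** Collects the facts about complex numbers on which the abstract sections above rely. *)
Lemma complex_extension : exists (K : fieldType) (rc : {rmorphism R -> K})
  (re im : {additive K -> R}) (iu : K),
  [/\ iu * iu = -1, forall z, z = rc (re z) + iu * rc (im z),
      forall z x, re (z * rc x) = re z * x, re 1 = 1 & re iu = 0].
Proof.
exists (R[i] : fieldType), (real_complex R), re_part, im_part, (Complex 0 1).
split=> //.
- by apply/eqP; rewrite eq_complex /=; apply/andP; split; apply/eqP; ring.
- exact: complexE.
- by move=> [u v] x; rewrite /re_part /= mulr0 subr0.
Qed.
End ComplexNumbers.

(** * The listed representatives and the assembly of the theorem *)

Section Representatives.
Variable R : realType.
Local Notation T := ({mpoly R[3]} * {mpoly R[3]} * {mpoly R[3]})%type.
Local Notation YY := (rspan [:: Y23 R; Y31 R; Y12 R]).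

Lemma YY_span : YY = rspan [seq mv2t t | t <- [:: Y23t R; Y31t R; Y12t R]].
Proof. by rewrite Y23E Y31E Y12E. Qed.

Lemma DcasE : Dcas R = fps_of (Dp R).
Proof. by rewrite /Dcas !fps_varE !fps_exp_of fps_ofD fps_mul_of. Qed.

Lemma YY_Dcas n : [set fps_scale (fps_exp (Dcas R) n) A | A in YY] =
  rspan [seq mv2t t | t <- esA R n].
Proof. by rewrite YY_span DcasE fps_exp_of rspan_scale. Qed.

Lemma YY_esA0 : YY = rspan [seq mv2t t | t <- esA R 0].
Proof.
have mulT1 (t : T) : mulT (Dp R ^+ 0) t = t.
  by case: t => [[? ?] ?]; rewrite /mulT expr0 !mul1r.
by rewrite YY_span /esA !mulT1.
Qed.

Lemma mv2tZD c (t u : T) : mv2t t + c *: mv2t u = mv2t (t + c *: u).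
Proof. by rewrite addrC -linearP addrC. Qed.

(** The separate case m = 1 agrees with the general formula because the factor n = 0 removes the x2
    term. *)
Lemma Wmm_span n : Wmm R n.+1 = rspan [seq mv2t t | t <- esB R n].
Proof.
rewrite /Wmm; case: n => [|n] /=.
  by rewrite /esB expr0 !mul0r d23E d31E.
pose es : seq T := [:: (x1, 0, 0); (n.+1%:R * x2, x1, 0)].
have Ees : [:: fps_scale (fps_of x1) (d23 R);
    fps_scale (fps_of x1) (d31 R) + n.+1%:R *: fps_scale (fps_of x2) (d23 R)]
    = [seq mv2t t | t <- es].
  rewrite d23E d31E -[mv2 1 0 0]/(mv2t (1, 0, 0)) -[mv2 0 1 0]/(mv2t (0, 1, 0)).
  rewrite !fps_scale_mv2t mv2tZD /es /mulT /= !mulr0 !mulr1.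
  congr [:: _; mv2t _]; congr (_, _, _); rewrite /= ?scaler0 ?addr0 ?add0r //.
  by rewrite -mul_mpolyC mpolyCnat.
rewrite !fps_varE fps_exp_of subn2 subn1 /= Ees rspan_scale /es /esB /mulT /=.
congr (rspan [:: mv2t _; mv2t _]); rewrite !mulr0 -?exprSr //.
by congr (_, _, _); ring.
Qed.

Lemma x3_span n : rspan [:: fps_scale (fps_exp (fps_var R ix3) n) (d12 R)] =
  rspan [seq mv2t t | t <- [:: (0, 0, x3 ^+ n) : T]].
Proof.
congr rspan; congr [:: _].
by rewrite fps_varE fps_exp_of d12E -[mv2 0 0 1]/(mv2t (0, 0,
    1)) fps_scale_mv2t /mulT /= !mulr0 mulr1.
Qed.

(** Lets the case of a single bidegree use the gluing results for families. *)
Lemma formal_sums_unit (V : set (mvf R)) : formal_sums (fun _ : unit => V) = V.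
Proof.
have sumE (F : unit -> mvf R) : is_formal_sum F (F tt).
  move=> I m; split; first exact: finite_finset.
  by rewrite (_ : [set: unit] = [set tt]) ?fsbig_set1 //; apply/seteqP; split=> // -[].
apply/seteqP; split=> A.
  by move=> [F VF FA]; rewrite (formal_sum_unique FA (sumE F)).
by move=> VA; exists (fun=> A) => //; exact: (sumE (fun=> A)).
Qed.
End Representatives.

Section ExactBidegrees.
Variables (R : realType) (a b : R).
Hypothesis b0 : b != 0.

Lemma exact_bidegree kr :
  (forall m : 'X_{1..3}, bad a m -> (m ix1 + m ix2, m ix1 + m ix2 + m ix3)%N <> kr) ->
  forall A, cocycles (Lam a b) (Rbi R kr) 2 A -> coboundaries (Lam a b) (Rbi R kr) 2 A.
Proof.
have [K [rc [re [im [iu [h1 h2 h3 h4 h5]]]]]] := complex_extension R.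
case: kr => k r off A cA; have [kr|rk] := leqP k r.
  rewrite -(subnKC kr) in cA off *.
  by apply: (exact_off h1 h2 h3 h4 h5 b0) cA => m bm e1 e2; apply: (off m bm);
      rewrite e1 e2.
(* For r < k the piece is zero, since the first entry of [wt] never exceeds the second. *)
suff -> : A = 0 by apply: coboundary0; exact: RbiP.
case: cA => /RbiP[//|_ hA] _; apply/funext => I; apply/funext => m.
apply/eqP; apply: contraT => /hA; rewrite /wt => -[e1 e2]; lia.
Qed.
End ExactBidegrees.

Theorem theorem3 (R : realType) (a b : R) :
  b != 0 ->
  let L : mvf R := b *: wedge (Y1 R) (Y2 R) + (2 * b) *: wedge (Y2 R) (Y3 R)
                   + a *: wedge (Y3 R) (Y1 R) in
  let YY : set (mvf R) := rspan [:: Y23 R; Y31 R; Y12 R] in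
  (* (i) *)
  (a != 0 ->
     [/\ cohomology_dsum L 2 (fun _ : unit => (2%N, 3%N)),
         cohomology_is L (Rbi R (2%N, 3%N)) 2 YY
       & cohomology_is L (Rformal R) 2 YY])
  /\
  (* (ii); the three families are indexed from 0 *)
  (a = 0 ->
     let idx : nat + nat + nat -> nat * nat := fun j =>
       match j with
       | inl (inl m) => ((2 * m.+1)%N, (3 * m.+1)%N)
       | inl (inr m) => (m.+1, m.+1)
       | inr m => (0%N, m.+1)
       end in
     let W : nat + nat + nat -> set (mvf R) := fun j =>
       match j with
       | inl (inl m) => [set fps_scale (fps_exp (Dcas R) m) A | A in YY]
       | inl (inr m) => Wmm R m.+1
       | inr m => rspan [:: fps_scale (fps_exp (fps_var R ix3) m) (d12 R)]
       end in
     [/\ cohomology_dsum L 2 idx,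
         forall j, cohomology_is L (Rbi R (idx j)) 2 (W j),
         formally_direct W
       & cohomology_is L (Rformal R) 2 (formal_sums W)]).
Proof.
move=> b0 L YY.
have [K [rc [re [im [iu [h1 h2 h3 h4 h5]]]]]] := complex_extension R.
have wL : in_wt (2, 3)%N L := @Lam_wt R a b.
have cohA n : a = 0 \/ n = 0%N -> cohomology_is L (Rbi R (2 * n.+1,
    2 * n.+1 + n.+1)%N) 2
    (rspan [seq mv2t t | t <- esA R n]) := cohomology_A h1 h2 h3 h4 h5 b0 (n := n).
split=> [a0|a0 idx W].
  have coh : cohomology_is L (Rbi R (2, 3)%N) 2 YY.
    by rewrite /YY YY_esA0; exact: (cohA 0%N (or_intror erefl)).
  have inj : injective (fun _ : unit => (2, 3)%N) by move=> [] [].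
  have off kr : (forall j : unit, (2, 3)%N <> kr) ->
      forall A, cocycles L (Rbi R kr) 2 A -> coboundaries L (Rbi R kr) 2 A.
    move=> nkr; apply: (exact_bidegree b0) => m bm; move: (nkr tt).
    (* For a != 0 the only exceptional monomial is z z' x3, of bidegree (2, 3). *)
    case: bm => [[_ -> -> [a1|->]]|[a1]|[a1]|[a1]] //; by rewrite a1 eqxx in a0.
  split=> //.
    exact: (gluing_dsum wL inj (@RbiP R) off).
  rewrite -(formal_sums_unit YY).
  exact: (gluing_cohomology (W := fun=> YY) wL inj (@RbiP R) (fun=> coh) off).
have inj : injective idx.
  move=> [[m|m]|m] [[n|n]|n] /= [] => *; try (exfalso; lia);
    [congr (inl (inl _))|congr (inl (inr _))|congr (inr _)]; lia.
have coh j : cohomology_is L (Rbi R (idx j)) 2 (W j).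
  case: j => [[n|n]|n]; rewrite /idx /W.
  - rewrite /YY YY_Dcas (_ : 3 * n.+1 = 2 * n.+1 + n.+1)%N; last by lia.
    by apply: cohA; left.
  - have := cohomology_B h1 h2 h3 h4 h5 b0 n a0.
    by rewrite Wmm_span addn0.
  - have := cohomology_C h1 h2 h3 h4 h5 b0 n a0.
    by rewrite x3_span add0n.
have off kr : (forall j, idx j <> kr) ->
    forall A, cocycles L (Rbi R kr) 2 A -> coboundaries L (Rbi R kr) 2 A.
  move=> nkr; apply: (exact_bidegree b0) => m.
  (* Powers of z' and of z both fall into the second family. The predecessors below account for
     families indexed from 0. *)
  case=> [[m3 -> -> _]|[_ -> m2 ->]|[_ -> m1 ->]|[_ -> -> m3]] e.
  - apply: (nkr (inl (inl (m ix3).-1))); rewrite -e /idx prednK //; congr (_, _); lia.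
  - apply: (nkr (inl (inr (m ix2).-1))); rewrite -e /idx prednK //; congr (_, _); lia.
  - apply: (nkr (inl (inr (m ix1).-1))); rewrite -e /idx prednK //; congr (_, _); lia.
  - by apply: (nkr (inr (m ix3).-1)); rewrite -e /idx prednK.
split=> //.
- exact: (gluing_dsum wL inj (@RbiP R) off).
- exact: (gluing_direct inj (@RbiP R) coh).
- exact: (gluing_cohomology wL inj (@RbiP R) coh off).
Qed.
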